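(* Let $k$ be a field of characteristic zero, let $R = k[x_1, \ldots, x_d]$ be a polynomial ring in $d > 1$ variables, and let $\mathfrak{m} = (x_1,\ldots,x_d)$ be its maximal homogeneous ideal. Let $I \subset R$ be a homogeneous ideal. Then the limit $$\lim_{n \to \infty} \frac{\lambda(H^0_{\mathfrak m}(R/I^n))}{n^d}$$ exists, and $$\lim_{n \to \infty} \frac{\lambda(H^0_{\mathfrak m}(R/I^n))}{n^d}=\lim_{n \to \infty} \frac{\lambda(\operatorname{Ext}^d_R(R/I^n,R(-d)))}{n^d}.$$
   Context: $\lambda(M)$ denotes the length of an $R$-module $M$ of finite length. $H^0_{\mathfrak m}$ denotes the zeroth local cohomology with support in $\mathfrak m$. $R(-d)$ denotes $R$ with grading shifted by $-d$. *)

(* Defs.v *)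
From HB Require Import structures.
From mathcomp Require Import all_boot all_order all_algebra.
From mathcomp Require Import mpoly.
From Stdlib Require Reals.

Set Implicit Arguments.
Unset Strict Implicit.
Unset Printing Implicit Defensive.

Import GRing.Theory.
Local Open Scope ring_scope.

Section CommAlg.
Variables (k : fieldType) (d : nat).
Local Notation R := {mpoly k[d]}.

Definition is_ideal (I : R -> Prop) : Prop :=
  I 0 /\ (forall a b, I a -> I b -> I (a + b)) /\ (forall r a, I a -> I (r * a)).

Definition hcomp (t : nat) (f : R) : R :=
  \sum_(m <- msupp f | mdeg m == t) f@_m *: 'X_[m].

Definition is_homog_ideal (I : R -> Prop) : Prop :=
  is_ideal I /\ forall f t, I f -> I (hcomp t f).

Definition ideal_pow (I : R -> Prop) (n : nat) (f : R) : Prop :=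
  exists s : seq (R * n.-tuple R),
    (forall p, p \in s -> forall x, x \in tval p.2 -> I x) /\
    f = \sum_(p <- s) p.1 * \prod_(x <- tval p.2) x.

Definition max_hom (f : R) : Prop :=
  exists c : 'I_d -> R, f = \sum_(i < d) c i * 'X_i.

(* preimage in R of H^0_m(R/J) = { f + J | m^t f ⊆ J for some t } *)
Definition H0m_pre (J : R -> Prop) (f : R) : Prop :=
  exists t : nat, forall g, ideal_pow max_hom t g -> J (g * f).

Definition is_submod (V : lmodType R) (S : V -> Prop) : Prop :=
  S 0 /\ forall (a : R) (u v : V), S u -> S v -> S (a *: u + v).

Definition mchain (V : lmodType R) (N P : V -> Prop) (C : nat -> V -> Prop)
  (l : nat) : Prop :=
  (forall i, (i <= l)%N -> is_submod (C i)) /\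
  (forall v, C 0%N v <-> N v) /\ (forall v, C l v <-> P v) /\
  (forall i, (i < l)%N ->
     (forall v, C i v -> C i.+1 v) /\ exists v, C i.+1 v /\ ~ C i v).

(* the R-module P/N (N ⊆ P submodules of V) has length exactly l *)
Definition mlength (V : lmodType R) (N P : V -> Prop) (l : nat) : Prop :=
  (exists C, mchain N P C l) /\ (forall C l', mchain N P C l' -> (l' <= l)%N).

(* A free resolution of R/J :
     ... -> R^(r 2) --D 1--> R^(r 1) --D 0--> R^(r 0) --eps--> R/J -> 0
   with D i : 'M_(r i.+1, r i) acting on row vectors, and eps(v) = v *m c mod J. *)
Definition free_resolution (J : R -> Prop) (r : nat -> nat)
  (D : forall i, 'M[R]_(r i.+1, r i)) (c : 'cV[R]_(r 0%N)) : Prop :=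
  (exists v : 'rV[R]_(r 0%N), J (1 - (v *m c) 0 0)) /\
  (forall v : 'rV[R]_(r 0%N),
      J ((v *m c) 0 0) <-> exists w : 'rV[R]_(r 1%N), v = w *m D 0%N) /\
  (forall i (v : 'rV[R]_(r i.+1)),
      v *m D i = 0 <-> exists w : 'rV[R]_(r i.+2), v = w *m D i.+1).

(* length of the i-th cohomology of Hom_R(F, R), F the resolution above:
   Hom_R(R^a, R) = column vectors, dual of D i is u |-> D i *m u. *)
Definition ext_length (r : nat -> nat) (D : forall i, 'M[R]_(r i.+1, r i))
  (i : nat) (l : nat) : Prop :=
  match i with
  | 0%N => mlength (fun v : 'cV[R]_(r 0%N) => v = 0)
                   (fun v => D 0%N *m v = 0) l
  | j.+1 => mlength (fun v : 'cV[R]_(r j.+1) => exists w : 'cV[R]_(r j), v = D j *m w)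
                    (fun v => D j.+1 *m v = 0) l
  end.

End CommAlg.

Definition normseq (a : nat -> nat) (d : nat) : nat -> Rdefinitions.R :=
  fun n => Rdefinitions.Rdiv (Raxioms.INR (a n)) (Rpow_def.pow (Raxioms.INR n) d).

(* Main.v *)
(* Write R = k[x_1, ..., x_d], M for the maximal homogeneous ideal and J^sat for the preimage in R
   of H^0_M(R/J).

   Existence of the limit.  Counting leading monomials, the length of H^0_M(R/I^n) is the number of
   monomials of in((I^n)^sat) outside in(I^n).  By noetherianity of the M-torsion of the associated
   graded ring of I, these monomials have degree at most cn + c, so the number is a difference of
   two counts of the form s(n) = #(E_n meet [0, Cn)^d), where the E_n are sets of monomials closed
   under multiplication by monomials and E_a E_b is contained in E_(a+b).  If p is in E_1 and C
   bounds p, each m in E_N with coordinates below CN gives a cube q m + r p + [0, q)^d inside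
   E_(qN+r), and these cubes are disjoint.  Hence s(qN + r) >= q^d s(N), and s(n)/n^d converges to
   its supremum.

   The two lengths agree.  Let F be a free resolution of R/J with J homogeneous, and let q_j be
   generated by x_1^t, ..., x_j^t.  Passing from q_j to q_(j+1) one variable at a time identifies
   H_d(F/q_d F) with (J : q_d)/J, which is J^sat/J for large t.  Since R/q_d is self-dual, this is
   also the dimension of H^d(Hom(F, R/q_d)), while H^(d+1)(Hom(F, R/q_d)) = 0.  Going back from
   q_d to 0 by Nakayama's lemma, E = Ext^d(R/J, R) satisfies dim E/q_d E = dim J^sat/J for all large
   t; so q_d E stabilises, and Nakayama again gives q_d E = 0.  Nakayama's lemma is available because
   annihilators of Ext modules are stable under x_i -> a x_i (by comparison of resolutions), hence
   homogeneous as k is infinite, so that an element of 1 + M in such an annihilator yields 1. *)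
Require Import Defs.
From HB Require Import structures.
From mathcomp Require Import all_boot all_order all_algebra.
From mathcomp Require Import mpoly.
From Stdlib Require Reals Lra.
From Stdlib Require Import ClassicalEpsilon.

Set Implicit Arguments.
Unset Strict Implicit.
Unset Printing Implicit Defensive.

Import Order.TTheory GRing.Theory.
Local Open Scope ring_scope.

Lemma fun_choice (A B : Type) (Q : A -> B -> Prop) :
  (forall x, exists y, Q x y) -> exists f, forall x, Q x (f x).
Proof.
move=> h; exists (fun x => proj1_sig (constructive_indefinite_description _ (h x))).
by move=> x; case: constructive_indefinite_description.
Qed.

Lemma ex_min_prop (Q : nat -> Prop) n :
  Q n -> exists m, Q m /\ forall j, (j < m)%N -> ~ Q j.
Proof.
elim/ltn_ind: n => n IH Qn.
case: (classic (exists j, (j < n)%N /\ Q j)) => [[j [ltj Qj]]|nex]; first exact: IH Qj.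
by exists n; split=> // j ltj Qj; apply: nex; exists j.
Qed.

(** * Dimensions and lengths of subquotients *)

Section Dimension.
Variables (k : fieldType) (d : nat).
Local Notation R := {mpoly k[d]}.

Section OneModule.
Variable V : lmodType R.
Implicit Types (N P : V -> Prop).

Definition subspace N : Prop :=
  N 0 /\ forall (a : k) u v, N u -> N v -> N (a%:MP *: u + v).

Lemma submod_subspace N : is_submod N -> subspace N.
Proof. by case=> N0 NS; split=> // a u v; apply: NS. Qed.

Lemma submodZ N : is_submod N -> forall a v, N v -> N (a *: v).
Proof. by case=> N0 NS a v Nv; rewrite -[_ *: _]addr0; apply: NS. Qed.

Lemma submodD N : is_submod N -> forall u v, N u -> N v -> N (u + v).
Proof. by case=> N0 NS u v Nu Nv; rewrite -[u]scale1r; apply: NS. Qed.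

Lemma submodN N : is_submod N -> forall v, N v -> N (- v).
Proof. by move=> sN v Nv; rewrite -scaleN1r; apply: submodZ. Qed.

Lemma submodB N : is_submod N -> forall u v, N u -> N v -> N (u - v).
Proof. by move=> sN u v Nu Nv; apply: submodD => //; apply: submodN. Qed.

Lemma submod_sum N : is_submod N -> forall (I : Type) (s : seq I) (p : pred I) (F : I -> V),
  (forall i, p i -> N (F i)) -> N (\sum_(i <- s | p i) F i).
Proof. by move=> sN I s p F h; apply: (big_ind N) => //; [case: sN|apply: submodD]. Qed.

Lemma submod_eqmod N : is_submod N -> forall u v, N (u - v) -> N v -> N u.
Proof. by move=> sN u v Nuv Nv; rewrite -(subrK v u); apply: submodD. Qed.

Lemma subspaceZ N : subspace N -> forall a v, N v -> N (a%:MP *: v).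
Proof. by case=> N0 NS a v Nv; rewrite -[_ *: _]addr0; apply: NS. Qed.

Lemma subspaceD N : subspace N -> forall u v, N u -> N v -> N (u + v).
Proof. by case=> N0 NS u v Nu Nv; rewrite -[u]scale1r -mpolyC1; apply: NS. Qed.

Lemma subspaceN N : subspace N -> forall v, N v -> N (- v).
Proof. by move=> sN v Nv; rewrite -scaleN1r -mpolyC1 -mpolyCN; apply: subspaceZ. Qed.

Lemma subspaceB N : subspace N -> forall u v, N u -> N v -> N (u - v).
Proof. by move=> sN u v Nu Nv; apply: subspaceD => //; apply: subspaceN. Qed.

Lemma subspace_sum N : subspace N -> forall (I : Type) (s : seq I) (p : pred I) (F : I -> V),
  (forall i, p i -> N (F i)) -> N (\sum_(i <- s | p i) F i).
Proof. by move=> sN I s p F h; apply: (big_ind N) => //; [case: sN|apply: subspaceD]. Qed.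

Lemma subspace_eqmod N : subspace N -> forall u v, N (u - v) -> N v -> N u.
Proof. by move=> sN u v Nuv Nv; rewrite -(subrK v u); apply: subspaceD. Qed.

Definition comb l (a : 'I_l -> k) (b : 'I_l -> V) : V := \sum_i (a i)%:MP *: b i.

Lemma subspace_comb N : subspace N -> forall l (a : 'I_l -> k) b,
  (forall i, N (b i)) -> N (comb a b).
Proof. by move=> sN l a b Nb; apply: subspace_sum => // i _; apply: subspaceZ. Qed.

Definition indep N l (b : 'I_l -> V) : Prop :=
  forall a, N (comb a b) -> forall i, a i = 0.

(** For subspaces this is the dimension over [k] of $P/(N \cap P)$; a basis of [P] modulo [N] as
    witness avoids forming quotient modules. *)
Definition kdim N P l : Prop :=
  exists b : 'I_l -> V,
    (forall i, P (b i)) /\ (forall v, P v -> exists a, N (v - comb a b)) /\ indep N b.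

(** If [m] exceeded [l], the matrix of coordinates of the [w i] would have a nonzero vector in its
    left kernel, a relation modulo [N]. *)
Lemma indep_le N P l m (w : 'I_m -> V) : subspace N -> kdim N P l ->
  (forall i, P (w i)) -> indep N w -> (m <= l)%N.
Proof.
move=> sN [b [_ [span _]]] Pw iw; rewrite leqNgt; apply/negP => ltlm.
have [A hA] := fun_choice (fun i => span _ (Pw i)).
pose M := \matrix_(i, j) A i j.
have : kermx M != 0.
  rewrite kermx_eq0 /row_free neq_ltn; apply/orP; left.
  by apply: leq_ltn_trans ltlm; apply: rank_leq_col.
case/rowV0Pn => u /sub_kermxP uM /eqP; apply; apply/rowP => i; rewrite mxE.
apply: (iw (fun i => u 0 i)).
have: N (comb (fun i => u 0 i) (fun i => w i - comb (A i) b)) by apply: subspace_comb.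
rewrite /comb; under eq_bigr do rewrite scalerBr.
rewrite sumrB; set x := \sum_i _; set y := \sum_i _; suff -> : y = 0 by rewrite subr0.
rewrite /y; under eq_bigr do rewrite scaler_sumr; rewrite exchange_big /=.
apply: big1 => j _; under eq_bigr do rewrite scalerA.
rewrite -scaler_suml; have -> : \sum_i0 (u 0 i0)%:MP * (A i0 j)%:MP = ((u *m M) 0 j)%:MP_[d].
  by rewrite mxE raddf_sum /=; apply: eq_bigr => i0 _; rewrite mpolyCM mxE.
by rewrite uM mxE mpolyC0 scale0r.
Qed.

(** A vector of [N'] outside [N], put in front of a basis of [P] modulo [N'], would give [l.+1]
    independent vectors modulo [N]. This later makes a decreasing family of constant codimension
    stabilise. *)
Lemma kdim_nested_eq N N' P l : subspace N -> subspace N' -> 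
  (forall v, N v -> N' v) -> (forall v, N' v -> P v) ->
  kdim N P l -> kdim N' P l -> forall v, N' v -> N v.
Proof.
move=> sN sN' NN' N'P kl [b [Pb [_ ib]]] v N'v; apply: NNPP => nNv.
pose w (i : 'I_l.+1) := if unlift ord0 i is Some j then b j else v.
suff : (l.+1 <= l)%N by rewrite ltnn.
apply: (indep_le (w := w) sN kl) => [i|a].
  by rewrite /w; case: unlift => [j|] //; apply: N'P.
rewrite /comb big_ord_recl /w unlift_none; under eq_bigr do rewrite liftK.
move=> Na.
have a0 : forall j, a (lift ord0 j) = 0.
  apply: (ib (fun j => a (lift ord0 j))).
  rewrite -[comb _ _](addKr ((a ord0)%:MP *: v)).
  by apply: subspaceD; [exact: sN' | apply: subspaceN => //; exact: subspaceZ | exact: NN'].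
move: Na; rewrite big1 => [|j _]; last by rewrite a0 mpolyC0 scale0r.
rewrite addr0 => Na i; case: (unliftP ord0 i) => [j ->|->] //.
apply/eqP; apply: contraT => nz; case: nNv.
rewrite -[v]scale1r -mpolyC1 -(mulVf nz) mpolyCM -scalerA.
exact: subspaceZ.
Qed.

(** Basis exchange: [v] replaces a basis vector [b i0] at which its coordinate is nonzero. *)
Lemma kdim_quotient N P l v : subspace N -> kdim N P l.+1 -> P v -> ~ N v ->
  kdim (fun u => exists a : k, N (u - a%:MP *: v)) P l.
Proof.
move=> sN [b [Pb [span ib]]] Pv nNv.
have [a Na] := span v Pv.
have [i0 ai0] : exists i, a i != 0.
  apply: NNPP => h; apply: nNv; apply: (subspace_eqmod sN Na).
  rewrite /comb big1 => [|i _]; first by case: sN.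
  suff -> : a i = 0 by rewrite mpolyC0 scale0r.
  by apply/eqP; apply: contraT => ai; case: h; exists i.
have combD (c e : 'I_l.+1 -> k) : comb (fun i => c i + e i) b = comb c b + comb e b.
  by rewrite /comb -big_split; apply: eq_bigr => i _; rewrite mpolyCD scalerDl.
have combZ x (c : 'I_l.+1 -> k) : comb (fun i => x * c i) b = x%:MP *: comb c b.
  by rewrite /comb scaler_sumr; apply: eq_bigr => i _; rewrite mpolyCM scalerA.
have comb0 (c : 'I_l.+1 -> k) : c i0 = 0 ->
    comb c b = comb (fun j => c (lift i0 j)) (fun j => b (lift i0 j)).
  move=> ci0; rewrite /comb (bigD1_ord i0) //= ci0 mpolyC0 scale0r add0r //.
exists (fun j => b (lift i0 j)); split; first by [].
split=> [u Pu|c [x Nc]].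
  have [c Nc] := span u Pu.
  pose e i := c i + (- (c i0 / a i0)) * a i.
  exists (fun j => e (lift i0 j)), (c i0 / a i0).
  rewrite -comb0; last by rewrite /e mulNr divfK // subrr.
  rewrite combD combZ mpolyCN scaleNr.
  have -> : u - (comb c b - (c i0 / a i0)%:MP *: comb a b) - (c i0 / a i0)%:MP *: v
    = (u - comb c b) - (c i0 / a i0)%:MP *: (v - comb a b).
    by rewrite scalerBr !opprB !addrA; congr (_ - _); rewrite -!addrA; congr (_ + _); rewrite addrC.
  by apply: subspaceB => //; apply: subspaceZ.
pose e i := (if unlift i0 i is Some j then c j else 0) + (- x) * a i.
have e0 : forall i, e i = 0.
  apply: ib; rewrite combD combZ mpolyCN scaleNr comb0 ?unlift_none //.
  have -> : comb (fun j => match unlift i0 (lift i0 j) with Some j0 => c j0 | None => 0 end)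
               (fun j => b (lift i0 j)) = comb c (fun j => b (lift i0 j)).
    by apply: eq_bigr => j _; rewrite liftK.
  rewrite (_ : _ - _ = (comb c (fun j => b (lift i0 j)) - x%:MP *: v)
                     + x%:MP *: (v - comb a b)); last by rewrite scalerBr addrA subrK.
  by apply: subspaceD => //; apply: subspaceZ.
have x0 : x = 0.
  move: (e0 i0); rewrite /e unlift_none add0r mulNr => /eqP.
  by rewrite oppr_eq0 mulf_eq0 (negPf ai0) orbF => /eqP.
by move=> j; move: (e0 (lift i0 j)); rewrite /e liftK x0 oppr0 mul0r addr0.
Qed.

(** Treat the variables in turn: replace the vector by its last multiple by a power of $x_i$ still
    outside [N]. The variables treated before keep sending it into [N]. *)
Lemma socle_vector N P t : is_submod N -> is_submod P ->
  (forall (i : 'I_d) v, P v -> N ('X_i ^+ t *: v)) ->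
  (exists v, P v /\ ~ N v) -> exists v, P v /\ ~ N v /\ forall i : 'I_d, N ('X_i *: v).
Proof.
move=> sN sP nil [v0 [Pv0 nNv0]].
suff [v [Pv [nNv h]]] : exists v, P v /\ ~ N v /\ forall i, i \in enum 'I_d -> N ('X_i *: v).
  by exists v; split=> //; split=> // i; apply: h; rewrite mem_enum.
elim: (enum 'I_d) => [|i s [v [Pv [nNv IH]]]]; first by exists v0.
have [e [Ne mine]] := ex_min_prop (Q := fun e => N ('X_i ^+ e *: v)) (nil i v Pv).
case: e Ne mine => [|e] Ne mine; first by case: nNv; move: Ne; rewrite expr0 scale1r.
exists ('X_i ^+ e *: v); split; first exact: submodZ.
split; first exact: mine.
move=> j; rewrite inE => /orP [/eqP->|js]; first by rewrite scalerA -exprS.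
by rewrite scalerA mulrC -scalerA; apply: submodZ => //; apply: IH.
Qed.

(** Monomials other than 1 send a socle vector into [N], so polynomials act on it through their
    constant term and its line is a submodule modulo [N]. *)
Lemma scale_socle N v : is_submod N -> (forall i : 'I_d, N ('X_i *: v)) ->
  forall a : R, N (a *: v - (a@_0%MM)%:MP *: v).
Proof.
move=> sN h; elim/mpolyind => [|c m p _ _ IH].
  by rewrite mcoeff0 mpolyC0 !scale0r subr0; case: sN.
rewrite mcoeffD mpolyCD !scalerDl opprD addrACA; apply: submodD => //.
rewrite mcoeffZ mcoeffX; case: (altP (m =P 0%MM)) => [->|m0].
  by rewrite mulr1 mpolyX0 -[c *: 1]/(c%:A) alg_mpolyC subrr; case: sN.
rewrite mulr0 mpolyC0 scale0r subr0.
have [i mi] : exists i, m i != 0%N.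
  apply: NNPP => hn; case/eqP: m0; apply/mnmP => i; rewrite mnm0E.
  by apply/eqP; apply: contraT => mi; case: hn; exists i.
have le : (U_(i) <= m)%MM by rewrite lep1mP.
rewrite -(submK le) mpolyXD -mul_mpolyC mulrA -scalerA.
exact: submodZ.
Qed.

(** Each step adjoins a socle vector of $P/N$, which lowers the remaining dimension by exactly
    one. *)
Lemma mchain_exists N P l t : is_submod N -> is_submod P -> (forall v, N v -> P v) ->
  (forall (i : 'I_d) v, P v -> N ('X_i ^+ t *: v)) ->
  kdim N P l -> exists C, mchain N P C l.
Proof.
elim: l N => [|l IH] N sN sP NP nil kd.
  exists (fun _ => N); split; first by [].
  split; first by [].
  split; last by [].
  move=> v; split; first exact: NP.
  case: kd => b [_ [span _]] /span [a]; rewrite /comb big_ord0 subr0 //.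
have [v [Pv [nNv sv]]] : exists v, P v /\ ~ N v /\ forall i : 'I_d, N ('X_i *: v).
  apply: (socle_vector sN sP nil); case: kd => b [Pb [_ ib]].
  exists (b ord0); split=> // Nb.
  have /(_ ord0) : forall i : 'I_l.+1, (i == ord0)%:R = 0 :> k.
    apply: (ib (fun i => (i == ord0)%:R)); rewrite /comb big_ord_recl eqxx mpolyC1 scale1r big1 ?addr0 //.
    by move=> i _; rewrite mpolyC0 scale0r.
  by rewrite eqxx => /eqP; rewrite oner_eq0.
have kd' := kdim_quotient (submod_subspace sN) kd Pv nNv.
set N' := (fun u => exists a : k, _) in kd'.
have NN' u : N u -> N' u by exists 0; rewrite mpolyC0 scale0r subr0.
have sN' : is_submod N'.
  split; first by apply: NN'; case: sN.
  move=> a u w [x Nx] [y Ny].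
  exists ((a * x%:MP)@_0 + y).
  have -> : a *: u + w - ((a * x%:MP)@_0 + y)%:MP *: v = a *: (u - x%:MP *: v)
     + ((a * x%:MP) *: v - ((a * x%:MP)@_0)%:MP *: v) + (w - y%:MP *: v).
    by rewrite mpolyCD scalerDl scalerBr scalerA (addrA (_ - _)) subrK opprD addrACA.
  by apply: submodD => //; apply: submodD => //; [apply: submodZ | apply: scale_socle].
have N'P u : N' u -> P u.
  case=> x Nx; apply: (submod_eqmod sP (v := x%:MP *: v)); [exact: NP | exact: submodZ].
have nil' (i : 'I_d) u : P u -> N' ('X_i ^+ t *: u) by move=> Pu; apply/NN'/nil.
have [C [sC [C0 [Cl inc]]]] := IH N' sN' sP N'P nil' kd'.
exists (fun i => if i is j.+1 then C j else N); split; first by case=> // j; apply: sC.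
split; first by [].
split; first by [].
case=> [_|j]; last exact: inc.
split; first by move=> u /NN' /C0.
exists v; split=> //; apply/C0; exists 1; rewrite mpolyC1 scale1r subrr; by case: sN.
Qed.

Lemma mchain_le N P l C l' : is_submod N -> kdim N P l -> mchain N P C l' -> (l' <= l)%N.
Proof.
move=> sN kd [sC [C0 [Cl inc]]].
have mono i j : (i <= j)%N -> (j <= l')%N -> forall v, C i v -> C j v.
  elim: j => [|j IH]; first by rewrite leqn0 => /eqP->.
  rewrite leq_eqVlt => /orP [/eqP->|] // lij lj v Cv.
  by apply: (inc j lj).1; apply: IH => //; apply: ltnW.
have [w hw] := fun_choice (fun i : 'I_l' => (inc i (ltn_ord i)).2).
apply: (indep_le (w := w) (submod_subspace sN) kd) => [i|a Na].
  by apply/Cl; apply: (mono i.+1 l') => //; case: (hw i).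
(* Coefficients vanish from the top of the chain downwards: the last vector with nonzero coefficient
   in a relation would lie in the step below it. *)
have h n : (n <= l')%N -> forall i : 'I_l', (l' - n <= i)%N -> a i = 0.
  elim: n => [_ i|n IH ltn i]; first by rewrite subn0 leqNgt ltn_ord.
  have e : (l' - n.+1).+1 = (l' - n)%N by rewrite subnSK.
  rewrite leq_eqVlt e => /orP [/eqP ei|]; last by apply: IH; apply: ltnW.
  apply/eqP; apply: contraT => nz; case: (hw i) => _ []; rewrite -ei.
  have sCi : is_submod (C (l' - n.+1)%N) by apply: sC; apply: leq_subr.
  rewrite -[w i]scale1r -mpolyC1 -(mulVf nz) mpolyCM -scalerA; apply: submodZ => //.
  have -> : (a i)%:MP *: w i = comb a w - \sum_(j | j != i) (a j)%:MP *: w j.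
    by rewrite /comb (bigD1 i) //= addrK.
  apply: submodB => //.
    by apply: (mono 0%N) => //; [apply: leq_subr | apply/C0].
  apply: submod_sum => // j ji; case: (ltnP j i) => ij.
    apply: submodZ => //; apply: (mono j.+1); rewrite ?leq_subr ?ei //.
    by case: (hw j).
  rewrite (IH (ltnW ltn)) ?mpolyC0 ?scale0r; first by case: sCi.
  by rewrite -e ei ltn_neqAle ij andbT eq_sym.
by move=> i; apply: (h l') => //; rewrite subnn.
Qed.

(** Powers of the variables kill $P/N$, so its only possible composition factor is $R/\mathfrak m =
    k$. *)
Lemma mlength_kdim N P l t : is_submod N -> is_submod P -> (forall v, N v -> P v) ->
  (forall (i : 'I_d) v, P v -> N ('X_i ^+ t *: v)) ->
  kdim N P l -> mlength N P l.
Proof.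
move=> sN sP NP nil kd; split; first exact: mchain_exists nil kd.
by move=> C l'; apply: mchain_le.
Qed.

End OneModule.

(* Stated for relations, so that connecting homomorphisms can be used without choosing lifts. *)
Lemma kdim_corr (V V' : lmodType R) (N P : V -> Prop) (N' P' : V' -> Prop)
  (G : V -> V' -> Prop) l :
  G 0 0 -> (forall (a : k) u u' v v', G u u' -> G v v' -> G (a%:MP *: u + v) (a%:MP *: u' + v')) ->
  (forall v, P v -> exists v', P' v' /\ G v v') ->
  (forall v', P' v' -> exists v, P v /\ G v v') ->
  (forall v v', G v v' -> (N v <-> N' v')) ->
  kdim N P l -> kdim N' P' l.
Proof.
move=> G0 GS tot tot' GN [b [Pb [span ib]]].
have [b' hb'] := fun_choice (fun i => tot _ (Pb i)).
have Gc a : G (comb a b) (comb a b').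
  rewrite /comb; apply: (big_rec2 (fun u v => G v u)) => // i u v _ Guv.
  by apply: GS => //; case: (hb' i).
exists b'; split; first by move=> i; case: (hb' i).
split=> [v' Pv'|a Na]; last by apply: ib; apply/GN; eauto.
have [v [Pv Gv]] := tot' _ Pv'; have [a Na] := span _ Pv; exists a.
apply/(GN (v - comb a b)) => //.
have := GS (-1) _ _ _ _ (Gc a) Gv.
by rewrite mpolyCN mpolyC1 !scaleN1r ![- _ + _]addrC.
Qed.

End Dimension.

(** * Leading monomials *)

Section LeadingMonomials.
Variables (k : fieldType) (n : nat).
Local Notation R := {mpoly k[n]}.
Implicit Types (J : R -> Prop).

Definition lead_set J (m : 'X_{1..n}) : Prop := exists f, [/\ J f, f != 0 & mlead f = m].

Lemma ideal_submod J : is_ideal J -> is_submod (V := R^o) J.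
Proof. by case=> J0 [JD JM]; split=> // a u v Ju Jv; apply: JD => //; apply: JM. Qed.

Lemma reduce_lead (f h : R) : f != 0 -> h != 0 -> mlead h = mlead f ->
  let f' := f - (mleadc f / mleadc h) *: h in
  f' != 0 -> (mlead f' < mlead f)%O.
Proof.
move=> f0 h0 e f' f'0; rewrite lt_neqAle; apply/andP; split.
  apply: contra_neq f'0 => e'; apply/eqP; rewrite -mleadc_eq0 e' /f'.
  by rewrite mcoeffB mcoeffZ -e divfK ?subrr // mleadc_eq0.
apply: le_trans (mleadB_le _ _) _; rewrite leUx lexx /= -e; exact: mleadZ_le.
Qed.

(** Reduction along the well-founded monomial order: the caller supplies an [h] with the same
    leading monomial, and [f - c *: h] is zero or has a smaller one. *)
Lemma lead_ind J (Q : R -> Prop) : Q 0 ->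
  (forall f, J f -> f != 0 -> exists h c, [/\ h != 0, mlead h = mlead f, J (f - c *: h),
     c = mleadc f / mleadc h & (Q (f - c *: h) -> Q f)]) ->
  forall f, J f -> Q f.
Proof.
move=> Q0 step f; move: {2}(mlead f) (erefl (mlead f)) => m.
elim/(@ltmwf n): m f => m IH f em Jf.
case: (altP (f =P 0)) => [->|f0] //.
have [h [c [h0 e Jf' ec]]] := step f Jf f0; apply.
case: (altP (f - c *: h =P 0)) => [->|f'0] //.
apply: (IH _ _ _ erefl) => //; rewrite -em ec; apply: reduce_lead => //; by rewrite -ec.
Qed.

(** Choose an element of [J'] for each monomial of [s]. Cancelling leading terms by these or by
    elements of [J] gives spanning; distinct leading monomials outside the leading set of [J] give
    independence. *)
Lemma kdim_lead_set (J J' : R -> Prop) (s : seq 'X_{1..n}) :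
  is_ideal J -> is_ideal J' -> (forall f, J f -> J' f) -> uniq s ->
  (forall m, m \in s <-> lead_set J' m /\ ~ lead_set J m) ->
  kdim (V := R^o) J J' (size s).
Proof.
move=> iJ iJ' JJ' us hs.
have sJ := submod_subspace (ideal_submod iJ).
have sJ' := submod_subspace (ideal_submod iJ').
pose mon (i : 'I_(size s)) := nth 0%MM s i.
have hmon i : lead_set J' (mon i) /\ ~ lead_set J (mon i).
  by apply/hs; apply: mem_nth.
have [b hb] := fun_choice (fun i => (hmon i).1).
exists b; split; first by move=> i; case: (hb i).
split.
  apply: (lead_ind (J := J')).
    exists (fun _ => 0); rewrite sub0r; apply: subspaceN => //.
    by apply: subspace_sum => // i _; rewrite mpolyC0 scale0r; case: sJ.
  move=> f Jf f0.
  case: (classic (lead_set J (mlead f))) => [[h [Jh h0 e]]|nl].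
    exists h, (mleadc f / mleadc h); split=> //.
      by rewrite -mul_mpolyC; apply: (subspaceB sJ') => //; apply: (subspaceZ sJ'); apply: JJ'.
    case=> a Na; exists a; apply: (subspace_eqmod sJ (v := (mleadc f / mleadc h)%:MP * h)).
      by rewrite addrAC mul_mpolyC.
    exact: (subspaceZ sJ).
  have ms : mlead f \in s by apply/hs; split=> //; exists f.
  have lt : (index (mlead f) s < size s)%N by rewrite index_mem.
  have em : mon (Ordinal lt) = mlead f by rewrite /mon nth_index.
  have [Jh h0 e] := hb (Ordinal lt); rewrite em in e.
  exists (b (Ordinal lt)), (mleadc f / mleadc (b (Ordinal lt))); split=> //.
    by rewrite -mul_mpolyC; apply: (subspaceB sJ') => //; apply: (subspaceZ sJ').
  case=> a Na; exists (fun i => a i + if i == Ordinal lt then mleadc f / mleadc (b (Ordinal lt)) else 0).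
  rewrite (_ : comb (V := R^o) _ _ = comb (V := R^o) a b + (mleadc f / mleadc (b (Ordinal lt))) *: b (Ordinal lt)).
    by rewrite opprD [- comb _ _ + _]addrC addrA.
  rewrite /comb (eq_bigr (fun i => (a i)%:MP * b i + (if i == Ordinal lt then
     (mleadc f / mleadc (b (Ordinal lt)))%:MP * b i else 0))) => [|i _].
    rewrite big_split /= -big_mkcond big_pred1_eq mul_mpolyC //.
  by rewrite mpolyCD scalerDl; case: eqP => // _; rewrite mpolyC0 scale0r.
move=> a Ja i; apply/eqP; apply: contraT => ai.
(* The largest leading monomial with nonzero coefficient cannot cancel, so it leads the whole
   combination. *)
pose i0 := [arg max_(j > i | a j != 0) mon j]%O.
have [ai0 mx] : a i0 != 0 /\ forall j, a j != 0 -> (mon j <= mon i0)%O.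
  by rewrite /i0; case: arg_maxP => // j aj h; split=> // l /h.
have cf m : (comb (V := R^o) a b)@_m = \sum_j a j * (b j)@_m.
  by rewrite /comb raddf_sum; apply: eq_bigr => j _; rewrite /= mcoeffCM.
have c0 : (comb (V := R^o) a b)@_(mon i0) = a i0 * mleadc (b i0).
  have [_ _ e0] := hb i0; rewrite cf (bigD1 i0) //= e0 big1 ?addr0 // => j ji0.
  case: (altP (a j =P 0)) => [->|aj]; first by rewrite mul0r.
  have [_ _ e] := hb j; rewrite mcoeff_gt_mlead ?mulr0 // e lt_neqAle mx // andbT.
  by rewrite /mon nth_uniq // (inj_eq val_inj).
have cne : (comb (V := R^o) a b)@_(mon i0) != 0.
  by rewrite c0 mulf_neq0 // mleadc_eq0; case: (hb i0).
have c00 : comb (V := R^o) a b != 0 by apply: contra_neq cne => ->; rewrite mcoeff0.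
case: (hmon i0) => _ []; exists (comb (V := R^o) a b); split=> //.
apply/eqP; rewrite eq_le; apply/andP; split; last first.
  by apply: msupp_le_mlead; rewrite mcoeff_msupp.
rewrite leNgt; apply/negP => lt.
have := c00; rewrite -mleadc_eq0 cf big1 ?eqxx // => j _.
case: (altP (a j =P 0)) => [->|aj]; first by rewrite mul0r.
have [_ _ e] := hb j; rewrite mcoeff_gt_mlead ?mulr0 // e; exact: le_lt_trans (mx _ aj) lt.
Qed.

(** Induction on the number [r] of coordinates compared. A finite set for [r] coordinates settles
    all monomials whose next coordinate is at least its maximum [B]; each smaller value of that
    coordinate gets a finite set of its own. *)
Lemma dickson (A : 'X_{1..n} -> Prop) :
  exists s : seq 'X_{1..n}, (forall m, m \in s -> A m) /\
    forall m, A m -> exists2 m', m' \in s & (m' <= m)%MM.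
Proof.
suff /(_ n (leqnn n) A) [s [sA hs]] : forall r, (r <= n)%N -> forall A : 'X_{1..n} -> Prop,
    exists s : seq 'X_{1..n}, (forall m, m \in s -> A m) /\
    forall m, A m -> exists2 m', m' \in s & forall i : 'I_n, (i < r)%N -> (m' i <= m i)%N.
  by exists s; split=> // m /hs [m' m's h]; exists m' => //; apply/mnm_lepP => i; apply: h.
elim=> [_|r IH ltr] {}A.
  case: (classic (exists m, A m)) => [[m Am]|nA].
    by exists [:: m]; split=> [m'|m' _]; [rewrite inE => /eqP-> | exists m; rewrite ?inE].
  by exists [::]; split=> // m Am; case: nA; exists m.
have [s [sA hs]] := IH (ltnW ltr) A.
pose ir := Ordinal ltr.
have [f hf] := fun_choice (fun c => IH (ltnW ltr) (fun m => A m /\ m ir = c)).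
pose B := (\max_(m <- s) m ir)%N.
exists (s ++ flatten [seq f c | c <- iota 0 B]); split=> [m|m Am].
  rewrite mem_cat => /orP [/sA //|/flattenP [l /mapP [c _ ->]]].
  by case: (hf c) => h _ /h [].
case: (leqP B (m ir)) => [le|lt].
  have [m' m's h] := hs _ Am; exists m'; first by rewrite mem_cat m's.
  move=> i; rewrite ltnS leq_eqVlt => /orP [/eqP ei|]; last exact: h.
  have -> : i = ir by apply: val_inj.
  by apply: leq_trans le; rewrite /B; apply: (leq_bigmax_seq (F := fun m : 'X_{1..n} => m ir) m').
have [m' m's h] := (hf (m ir)).2 m (conj Am erefl); exists m'.
  rewrite mem_cat; apply/orP; right; apply/flattenP; exists (f (m ir)) => //.
  by apply: map_f; rewrite mem_iota.
move=> i; rewrite ltnS leq_eqVlt => /orP [/eqP ei|]; last exact: h.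
have -> : i = ir by apply: val_inj.
by case: ((hf (m ir)).1 _ m's) => _ ->.
Qed.

(** By Dickson's lemma finitely many leading monomials divide all others; elements realising them
    generate [J], by cancelling leading terms. *)
Lemma hilbert_basis J : is_ideal J -> exists p (g : 'I_p -> R),
  (forall i, J (g i)) /\ forall f, J f -> exists h : 'I_p -> R, f = \sum_i h i * g i.
Proof.
move=> iJ; have [s [sl hs]] := dickson (lead_set J).
have hmon (i : 'I_(size s)) : lead_set J (nth 0%MM s i) by apply/sl/mem_nth.
have [g hg] := fun_choice hmon.
exists (size s), g; split; first by move=> i; case: (hg i).
apply: (lead_ind (J := J)).
  by exists (fun _ => 0); rewrite big1 // => i _; rewrite mul0r.
move=> f Jf f0; have [|m' m's le] := hs (mlead f); first by exists f.
have lt : (index m' s < size s)%N by rewrite index_mem.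
pose i := Ordinal lt; have [Jg g0 e] := hg i; rewrite nth_index // in e.
pose h := 'X_[mlead f - m'] * g i.
have X0 (m : 'X_{1..n}) : 'X_[m] != 0 :> R by rewrite -mleadc_eq0 mleadXm mcoeffX eqxx oner_eq0.
have h0 : h != 0 by rewrite mulf_neq0.
have eh : mlead h = mlead f by rewrite mleadM // mleadXm e submK.
exists h, (mleadc f / mleadc h); split=> //.
  case: (iJ) => _ [JD JM]; apply: JD => //; rewrite -scaleNr -mul_mpolyC mulrA; exact: JM.
case=> c hc; exists (fun j => c j + if j == i then (mleadc f / mleadc h)%:MP * 'X_[mlead f - m'] else 0).
rewrite (eq_bigr (fun j => c j * g j + (if j == i then
    (mleadc f / mleadc h)%:MP * 'X_[mlead f - m'] * g j else 0))) => [|j _]; last first.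
  by rewrite mulrDl; case: eqP => // _; rewrite mul0r.
by rewrite big_split /= -hc -big_mkcond big_pred1_eq -mulrA mul_mpolyC subrK.
Qed.

(** Induction on the number [j] of coordinates allowed to be nonzero: the last of them runs through
    an ideal, and lifts of its generators reduce to vectors supported on the coordinates before. *)
Lemma noetherian_cV r (S : 'cV[R]_r -> Prop) : is_submod S -> exists p (g : 'I_p -> 'cV[R]_r),
  (forall i, S (g i)) /\ forall v, S v -> exists h : 'I_p -> R, v = \sum_i h i *: g i.
Proof.
move=> sS.
suff : forall j, (j <= r)%N -> exists p (g : 'I_p -> 'cV[R]_r),
  (forall i, S (g i)) /\ forall v, S v -> (forall i : 'I_r, (j <= i)%N -> v i 0 = 0) ->
  exists h : 'I_p -> R, v = \sum_i h i *: g i.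
  move=> /(_ r (leqnn _)) [p [g [Sg hg]]]; exists p, g; split=> // v Sv; apply: hg => // i.
  by rewrite leqNgt ltn_ord.
elim=> [_|j IH ltj].
  exists 0%N, (fun _ => 0); split=> [|v Sv v0]; first by case.
  by exists (fun _ => 0); rewrite big_ord0; apply/colP => i; rewrite v0 // mxE.
have [p [g [Sg hg]]] := IH (ltnW ltj).
pose ij := Ordinal ltj.
pose T v := S v /\ forall i : 'I_r, (j < i)%N -> v i 0 = 0.
pose L f := exists v, T v /\ v ij 0 = f.
have iL : is_ideal L.
  split; first by exists 0; split; [split; [by case: sS | by move=> i _; rewrite mxE] | rewrite mxE].
  split=> [a b [v [[Sv v0] ea]] [w [[Sw w0] eb]]|c a [v [[Sv v0] ea]]].
    exists (v + w); rewrite mxE ea eb; split=> //; split; first exact: submodD.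
    by move=> i ji; rewrite mxE v0 // w0 // addr0.
  exists (c *: v); rewrite mxE ea; split=> //; split; first exact: submodZ.
  by move=> i ji; rewrite mxE v0 // mulr0.
have [q [l [Ll hl]]] := hilbert_basis iL.
have [w hw] := fun_choice Ll.
exists (p + q)%N, (fun i => match split i with inl i => g i | inr i => w i end); split.
  by move=> i; case: (split i) => // i'; case: (hw i') => [[]].
move=> v Sv v0; have [h eh] : exists h : 'I_q -> R, v ij 0 = \sum_i h i * l i.
  by apply: hl; exists v; split=> //; split.
pose v' := v - \sum_i h i *: w i.
have [h' eh'] : exists h' : 'I_p -> R, v' = \sum_i h' i *: g i.
  apply: hg; first by apply: submodB => //; apply: submod_sum => // i _; apply: submodZ => //; case: (hw i) => [[]].
  move=> i; rewrite leq_eqVlt /v' => /orP [/eqP ei|ji]; rewrite !mxE summxE.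
    have -> : i = ij by apply: val_inj.
    rewrite eh -sumrB big1 // => a _; rewrite mxE; case: (hw a) => _ ->; exact: subrr.
  rewrite v0 // big1 ?subr0 // => a _; have [[_ h0] _] := hw a; by rewrite mxE h0 // mulr0.
exists (fun i => match split i with inl i => h' i | inr i => h i end).
rewrite big_split_ord /=; under eq_bigr do rewrite -[lshift _ _]/(unsplit (inl _)) unsplitK.
under [X in _ + X]eq_bigr do rewrite -[rshift _ _]/(unsplit (inr _)) unsplitK.
by rewrite -eh' /v' subrK.
Qed.

End LeadingMonomials.

(** * Powers and saturations of homogeneous ideals *)

Section Restriction.
Variables (k : fieldType) (n : nat).
Local Notation R := {mpoly k[n]}.
Implicit Types (P : pred 'X_{1..n}) (f g : R).

Definition restr P f : R := \sum_(m <- msupp f | P m) f@_m *: 'X_[m].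

Lemma mcoeff_restr P f m : (restr P f)@_m = if P m then f@_m else 0.
Proof.
rewrite /restr raddf_sum /=.
under eq_bigr do rewrite mcoeffZ mcoeffX.
case: (boolP (m \in msupp f)) => ms; last first.
  rewrite big_seq_cond big1 => [|m' /andP [m's _]].
    by rewrite (memN_msupp_eq0 ms) if_same.
  by case: eqP => [e|]; [rewrite -e m's in ms | rewrite mulr0].
rewrite big_mkcond /= (bigD1_seq m) ?msupp_uniq //= eqxx mulr1 big1 ?addr0 //.
by move=> m' ne; rewrite (negPf ne) mulr0 if_same.
Qed.

Lemma restrD P f g : restr P (f + g) = restr P f + restr P g.
Proof. by apply/mpolyP => m; rewrite mcoeffD !mcoeff_restr mcoeffD; case: ifP; rewrite ?addr0. Qed.

Lemma restr0 P : restr P 0 = 0.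
Proof. by apply/mpolyP => m; rewrite !mcoeff_restr mcoeff0 if_same. Qed.

Lemma restrZ P c f : restr P (c *: f) = c *: restr P f.
Proof. by apply/mpolyP => m; rewrite mcoeffZ !mcoeff_restr mcoeffZ; case: ifP; rewrite ?mulr0. Qed.

Lemma restr_sum P (T : Type) (s : seq T) (F : T -> R) :
  restr P (\sum_(i <- s) F i) = \sum_(i <- s) restr P (F i).
Proof. exact: (big_morph (restr P) (restrD P) (restr0 P)). Qed.

Lemma restrX P m : restr P 'X_[m] = if P m then 'X_[m] else 0.
Proof.
apply/mpolyP => m'; rewrite mcoeff_restr mcoeffX; case: (altP (m =P m')) => [<-|ne].
  by case: ifP; rewrite ?mcoeffX ?eqxx ?mcoeff0.
by rewrite if_same; case: ifP; rewrite ?mcoeffX ?(negPf ne) ?mcoeff0.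
Qed.

Lemma restr_mulX P m f : restr P ('X_[m] * f) = 'X_[m] * restr (fun m' => P (m + m')%MM) f.
Proof.
elim/mpolyind: f => [|c m' p _ _ IH]; first by rewrite mulr0 !restr0 mulr0.
rewrite mulrDr !restrD mulrDr IH -scalerAr !restrZ -mpolyXD !restrX.
by case: ifP; rewrite ?scaler0 ?mulr0 // -scalerAr mpolyXD.
Qed.

Lemma restr_eq P P' f : P =1 P' -> restr P f = restr P' f.
Proof. by move=> e; apply/mpolyP => m; rewrite !mcoeff_restr e. Qed.

Lemma restr_pred0 f : restr pred0 f = 0.
Proof. by apply/mpolyP => m; rewrite mcoeff_restr mcoeff0. Qed.

Lemma restr_restr P P' f : restr P (restr P' f) = restr (predI P P') f.
Proof. by apply/mpolyP => m; rewrite !mcoeff_restr /=; case: ifP. Qed.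

Lemma restr_id_mul P P' P'' f g : restr P f = f -> restr P' g = g ->
  (forall m m', P m -> P' m' -> P'' (m + m')%MM) -> restr P'' (f * g) = f * g.
Proof.
move=> ef eg h; apply/mpolyP => m; rewrite mcoeff_restr; case: ifP => // nP.
rewrite mcoeffM big1 // => -[[u hu] [v hv]] /= {hu hv} /eqP e.
rewrite -ef -eg !mcoeff_restr; case: ifP => Pu; rewrite ?mul0r //.
case: ifP => Pv; rewrite ?mulr0 //.
by rewrite e h in nP.
Qed.

End Restriction.

Section Ideals.
Variables (k : fieldType) (d : nat).
Local Notation R := {mpoly k[d]}.
Implicit Types (I J : R -> Prop) (f g : R).

Lemma ideal_pow_gen I n r (t : n.-tuple R) :
  (forall x, x \in tval t -> I x) -> ideal_pow I n (r * \prod_(x <- tval t) x).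
Proof.
by move=> It; exists [:: (r, t)]; rewrite big_seq1; split=> // p; rewrite inE => /eqP->.
Qed.

Lemma ideal_pow_ideal I n : is_ideal (ideal_pow I n).
Proof.
split; first by exists [::]; rewrite big_nil.
split=> [a b [s [sI ->]] [s' [s'I ->]]|r a [s [sI ->]]].
  exists (s ++ s'); rewrite big_cat; split=> // p; rewrite mem_cat => /orP [/sI|/s'I] //.
exists [seq (r * p.1, p.2) | p <- s]; split=> [p /mapP [q /sI qI ->]|] //.
by rewrite big_map mulr_sumr; apply: eq_bigr => p _; rewrite mulrA.
Qed.

Lemma ideal_sum J : is_ideal J -> forall (T : Type) (s : seq T) (p : pred T) (F : T -> R),
  (forall i, p i -> J (F i)) -> J (\sum_(i <- s | p i) F i).
Proof. by move=> /ideal_submod; apply: submod_sum. Qed.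

Lemma idealM J : is_ideal J -> forall r f, J f -> J (r * f).
Proof. by case=> _ []. Qed.

Lemma ideal0 J : is_ideal J -> J 0.
Proof. by case. Qed.

Lemma idealD J : is_ideal J -> forall f g, J f -> J g -> J (f + g).
Proof. by case=> _ []. Qed.

Lemma idealB J : is_ideal J -> forall f g, J f -> J g -> J (f - g).
Proof. by move=> /ideal_submod; apply: submodB. Qed.

Lemma idealZ J : is_ideal J -> forall (c : k) f, J f -> J (c *: f).
Proof. by move=> iJ c f Jf; rewrite -mul_mpolyC; apply: idealM. Qed.

Lemma ideal_pow_ind I n (Q : R -> Prop) : Q 0 -> (forall f g, Q f -> Q g -> Q (f + g)) ->
  (forall r (t : n.-tuple R), (forall x, x \in tval t -> I x) -> Q (r * \prod_(x <- tval t) x)) ->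
  forall f, ideal_pow I n f -> Q f.
Proof.
move=> Q0 QD QG f [s [sI ->]]; rewrite big_seq; apply: (big_ind Q) => // p /sI; exact: QG.
Qed.

Lemma ideal_powM I a b f g : ideal_pow I a f -> ideal_pow I b g -> ideal_pow I (a + b) (f * g).
Proof.
have iab := ideal_pow_ideal I (a + b).
move=> If Ig; move: f If; apply: ideal_pow_ind => [|f f' h h'|r t It].
- by rewrite mul0r; apply: ideal0.
- by rewrite mulrDl; apply: idealD.
move: g Ig; apply: ideal_pow_ind => [|g g' h h'|r' t' It'].
- by rewrite mulr0; apply: ideal0.
- by rewrite mulrDr; apply: idealD.
rewrite mulrACA -big_cat; apply: (@ideal_pow_gen _ _ _ (cat_tuple t t')) => x.
by rewrite mem_cat => /orP [/It|/It'].
Qed.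

Lemma ideal_pow0 I f : ideal_pow I 0 f.
Proof. by exists [:: (f, [tuple])]; rewrite big_seq1 big_nil mulr1; split=> // p; rewrite inE => /eqP->. Qed.

Lemma ideal_pow1 I f : is_ideal I -> (ideal_pow I 1 f <-> I f).
Proof.
move=> iI; split=> [|If]; last first.
  exists [:: (1, [tuple f])]; rewrite !big_seq1 mul1r; split=> // p.
  by rewrite inE => /eqP-> x; rewrite inE => /eqP->.
move: f; apply: ideal_pow_ind => [|f g|r t It]; [exact: ideal0|exact: idealD|].
apply: idealM => //; rewrite (tuple_eta t) /= (_ : behead t = [::]) ?big_seq1.
  by apply: It; rewrite mem_tnth.
by apply: size0nil; rewrite size_behead size_tuple.
Qed.

Lemma ideal_powS I n f : ideal_pow I n.+1 f -> ideal_pow I n f.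
Proof.
have iJ := ideal_pow_ideal I n.
move: f; apply: ideal_pow_ind => [|f g|r t It]; [exact: ideal0|exact: idealD|].
rewrite (tuple_eta t) /= big_cons mulrA; apply: (@ideal_pow_gen _ _ _ (behead_tuple t)) => x xt.
by apply: It; rewrite (tuple_eta t) inE xt orbT.
Qed.

Lemma hcompE t f : hcomp t f = restr (fun m => mdeg m == t) f.
Proof. by []. Qed.

Lemma mcoeff_hcomp t f m : (hcomp t f)@_m = if mdeg m == t then f@_m else 0.
Proof. exact: mcoeff_restr. Qed.

Lemma hcompD t f g : hcomp t (f + g) = hcomp t f + hcomp t g.
Proof. exact: restrD. Qed.

Lemma hcomp0 t : hcomp t (0 : R) = 0.
Proof. exact: restr0. Qed.

Lemma hcompZ t c f : hcomp t (c *: f) = c *: hcomp t f.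
Proof. exact: restrZ. Qed.

Lemma hcomp_mulX t m f : hcomp (mdeg m + t) ('X_[m] * f) = 'X_[m] * hcomp t f.
Proof.
rewrite !hcompE restr_mulX; congr (_ * _).
by apply: restr_eq => m'; rewrite mdegD eqn_add2l.
Qed.

Lemma hcomp_id t f : (forall m, m \in msupp f -> mdeg m = t) -> hcomp t f = f.
Proof.
move=> h; apply/mpolyP => m; rewrite mcoeff_hcomp; case: eqP => // ne.
by rewrite memN_msupp_eq0 //; apply/negP => /h.
Qed.

Lemma sum_hcomp f : f = \sum_(t < msize f) hcomp t f.
Proof.
apply/mpolyP => m; rewrite raddf_sum /=; under eq_bigr do rewrite mcoeff_hcomp.
case: (ltnP (mdeg m) (msize f)) => [lt|ge]; last first.
  by rewrite memN_msupp_eq0 ?msize_mdeg_ge // big1 // => i _; rewrite if_same.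
rewrite (bigD1 (Ordinal lt)) //= eqxx big1 ?addr0 // => i; rewrite -val_eqE /= eq_sym.
by case: eqP.
Qed.

Lemma hcomp_closedM (A B C : R -> Prop) f g : is_ideal C ->
  (forall u v, A u -> B v -> C (u * v)) ->
  (forall t, A (hcomp t f)) -> (forall t, B (hcomp t g)) -> forall t, C (hcomp t (f * g)).
Proof.
move=> iC AB Af Bg t.
rewrite (sum_hcomp f) (sum_hcomp g) mulr_suml hcompE restr_sum; apply: ideal_sum => // i _.
rewrite mulr_sumr restr_sum; apply: ideal_sum => // j _; change (C (hcomp t (hcomp i f * hcomp j g))).
suff -> : hcomp t (hcomp i f * hcomp j g) = if (i + j)%N == t then hcomp i f * hcomp j g else 0.
  by case: eqP => _; [apply: AB | apply: ideal0].
apply/mpolyP => m; rewrite mcoeff_hcomp.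
have z : mdeg m != (i + j)%N -> (hcomp i f * hcomp j g)@_m = 0.
  move=> ne; rewrite mcoeffM big1 // => -[a b] /= /eqP e.
  rewrite !mcoeff_hcomp; case: eqP => [ea|]; rewrite ?mul0r //.
  by case: eqP => [eb|]; rewrite ?mulr0 //; case/eqP: ne; rewrite e mdegD ea eb.
case: eqP => [e|ne]; case: eqP => [e'|ne'] //; rewrite ?mcoeff0 //.
  by apply: z; apply/eqP => e''; case: ne'; rewrite -e''.
by symmetry; apply: z; apply/eqP => e''; case: ne; rewrite e''.
Qed.

Lemma ideal_pow_homog I n : is_homog_ideal I -> is_homog_ideal (ideal_pow I n).
Proof.
move=> [iI hI]; have iJ := ideal_pow_ideal I n; split=> // f t; move: f; apply: ideal_pow_ind.
- by rewrite hcomp0; apply: ideal0.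
- by move=> f g; rewrite hcompD; apply: idealD.
move=> r u Iu; move: t; apply: (hcomp_closedM (A := fun _ => True) (B := ideal_pow I n)) => //.
  by move=> a b _; apply: idealM.
rewrite -{1}(size_tuple u); move: (tval u) Iu => {u iJ}.
elim=> [|x s IH] Is t; first exact: ideal_pow0.
rewrite big_cons; apply: (hcomp_closedM (A := I) (B := ideal_pow I (size s))).
- exact: ideal_pow_ideal.
- by move=> a b /(ideal_pow1 _ iI) ? ?; apply: (@ideal_powM _ 1).
- by move=> j; apply: hI; apply: Is; rewrite inE eqxx.
by apply: IH => y ys; apply: Is; rewrite inE ys orbT.
Qed.

Lemma low_coeffM a b f g :
  (forall m, (mdeg m < a)%N -> f@_m = 0) -> (forall m, (mdeg m < b)%N -> g@_m = 0) ->
  forall m, (mdeg m < a + b)%N -> (f * g)@_m = 0.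
Proof.
move=> fa gb m lt; rewrite mcoeffM big1 // => -[[u hu] [v hv]] /= {hu hv} /eqP e.
case: (ltnP (mdeg u) a) => [/fa->|ge]; rewrite ?mul0r //.
by rewrite gb ?mulr0 // -(ltn_add2l a); apply: leq_ltn_trans lt; rewrite e mdegD leq_add2r.
Qed.

Lemma max_hom_pow_coeff n f : ideal_pow (@max_hom k d) n f ->
  forall m, (mdeg m < n)%N -> f@_m = 0.
Proof.
have aux (s : seq R) : (forall x, x \in s -> max_hom x) ->
    forall m, (mdeg m < size s)%N -> (\prod_(x <- s) x)@_m = 0; last first.
  move=> + m lt; move: f; apply: ideal_pow_ind => [|f g|r t It]; first by rewrite mcoeff0.
    by rewrite mcoeffD => -> ->; rewrite addr0.
  by apply: (@low_coeffM 0 n) => // m' lt'; apply: aux => //; rewrite size_tuple.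
elim: s => [|x s IH] Is m //; rewrite big_cons; move: m; apply: (@low_coeffM 1 (size s)).
  move=> {}m; rewrite ltnS leqn0 mdeg_eq0 => /eqP->.
  have [c ->] : max_hom x by apply: Is; rewrite inE eqxx.
  rewrite raddf_sum /= big1 // => i _; apply: (@low_coeffM 0 1); rewrite ?mdeg0 //.
  move=> m'; rewrite ltnS leqn0 mdeg_eq0 mcoeffX => /eqP->.
  by case: eqP => // /eqP; rewrite mnm1_eq0.
by move=> m lt; apply: IH lt => y ys; apply: Is; rewrite inE ys orbT.
Qed.

Lemma pigeonhole_mnm (m : 'X_{1..d}) t : (0 < d)%N -> (d * t <= mdeg m)%N ->
  exists i, (t <= m i)%N.
Proof.
move=> d0 le; apply: NNPP => h.
have lt (i : 'I_d) : (m i < t)%N by rewrite ltnNge; apply/negP => ?; apply: h; exists i.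
have t0 : (0 < t)%N by apply: leq_ltn_trans (lt (Ordinal d0)).
move: le; rewrite leqNgt mdegE => /negP []; 
apply: (@leq_ltn_trans (\sum_(i < d) t.-1)%N).
  by apply: leq_sum => i _; rewrite -ltnS prednK.
by rewrite sum_nat_const card_ord ltn_mul2l d0 prednK ?leqnn.
Qed.

(** A monomial of degree at least $dt$ is divisible by some $x_i^t$, so $\mathfrak m^{dt}$ lies in
    the ideal generated by the $x_i^t$. *)
Lemma H0m_preP J f : (0 < d)%N -> is_ideal J ->
  (H0m_pre J f <-> exists t, forall i : 'I_d, J ('X_i ^+ t * f)).
Proof.
move=> d0 iJ; split=> [] [t h].
  exists t => i; apply: h; exists [:: (1, nseq_tuple t 'X_i)]; split.
    move=> p; rewrite inE => /eqP-> /= x; rewrite mem_nseq => /andP [_ /eqP->].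
    exists (fun j => (j == i)%:R); rewrite (bigD1 i) //= eqxx mul1r big1 ?addr0 //.
    by move=> j /negPf->; rewrite mul0r.
  by rewrite big_seq1 mul1r big_nseq iter_mulr_1.
exists (d * t)%N => g /max_hom_pow_coeff lo.
rewrite (mpolyE g) mulr_suml big_seq; apply: ideal_sum => // m mg.
have le : (d * t <= mdeg m)%N.
  by rewrite leqNgt; apply/negP => /lo e; move: mg; rewrite mcoeff_msupp e eqxx.
have [i lei] := pigeonhole_mnm d0 le.
have lem : (U_(i) *+ t <= m)%MM.
  by apply/mnm_lepP => j; rewrite mulmnE mnm1E; case: eqP => [<-|_]; rewrite ?mul1n ?mul0n.
rewrite -(submK lem) mpolyXD -mpolyXn -scalerAl -mulrA.
by apply: idealZ => //; apply: idealM.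
Qed.

End Ideals.

(** * Saturation with respect to the maximal homogeneous ideal *)

Section Saturation.
Variables (k : fieldType) (d : nat).
Hypothesis d0 : (0 < d)%N.
Local Notation R := {mpoly k[d]}.
Implicit Types (I J : R -> Prop) (f g : R).

Lemma expX_le J (i : 'I_d) t t' f : is_ideal J -> (t <= t')%N -> J ('X_i ^+ t * f) -> J ('X_i ^+ t' * f).
Proof. by move=> iJ le h; rewrite -(subnK le) exprD -mulrA; apply: idealM. Qed.

Lemma sub_H0m_pre J f : is_ideal J -> J f -> H0m_pre J f.
Proof. by move=> iJ Jf; apply/(H0m_preP _ d0 iJ); exists 0%N => i; rewrite expr0 mul1r. Qed.

Lemma H0m_pre_ideal J : is_ideal J -> is_ideal (H0m_pre J).
Proof.
move=> iJ; split; first by apply: sub_H0m_pre => //; apply: ideal0.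
split=> [a b /(H0m_preP _ d0 iJ) [t ht] /(H0m_preP _ d0 iJ) [u hu]|r a /(H0m_preP _ d0 iJ) [t ht]];
  apply/(H0m_preP _ d0 iJ).
  exists (maxn t u) => i; rewrite mulrDr; apply: idealD => //.
    exact: expX_le (leq_maxl _ _) (ht i).
  exact: expX_le (leq_maxr _ _) (hu i).
by exists t => i; rewrite mulrCA; apply: idealM.
Qed.

Lemma H0m_pre_homog J : is_homog_ideal J -> is_homog_ideal (H0m_pre J).
Proof.
move=> [iJ hJ]; split; first exact: H0m_pre_ideal.
move=> f t /(H0m_preP _ d0 iJ) [u hu]; apply/(H0m_preP _ d0 iJ); exists u => i.
by rewrite mpolyXn -hcomp_mulX -mpolyXn; apply: hJ.
Qed.

Lemma H0m_preM I a b f g : H0m_pre (ideal_pow I a) f -> H0m_pre (ideal_pow I b) g ->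
  H0m_pre (ideal_pow I (a + b)) (f * g).
Proof.
have P n h := H0m_preP h d0 (ideal_pow_ideal I n).
move=> /P [t ht] /P [u hu]; apply/P; exists (t + u)%N => i.
by rewrite exprD mulrACA; apply: ideal_powM.
Qed.

Lemma H0m_pre_uniform J : is_ideal J ->
  exists t, forall f, H0m_pre J f -> forall i : 'I_d, J ('X_i ^+ t * f).
Proof.
move=> iJ; have [p [g [Jg hg]]] := hilbert_basis (H0m_pre_ideal iJ).
have ex (i : 'I_p) : exists t, forall j : 'I_d, J ('X_j ^+ t * g i) by apply/(H0m_preP _ d0 iJ).
have [t ht] := fun_choice ex.
exists (\max_i t i)%N => f /hg [h ->] i; rewrite mulr_sumr; apply: ideal_sum => // j _.
rewrite mulrCA; apply: idealM => //; apply: expX_le (ht j i) => //; exact: leq_bigmax.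
Qed.

End Saturation.

(** * A linear bound on the degrees of the torsion *)

Section LinearBound.
Variables (k : fieldType) (d : nat).
Hypothesis d0 : (0 < d)%N.
Local Notation R := {mpoly k[d]}.
Variables (I : R -> Prop) (hI : is_homog_ideal I).
Variables (s : nat) (g : 'I_s -> R) (e : 'I_s -> nat).
Hypothesis Ig : forall j, I (g j).
Hypothesis gen : forall f, I f -> exists h : 'I_s -> R, f = \sum_j h j * g j.
Hypothesis gdeg : forall j m, m \in msupp (g j) -> mdeg m = e j.

Local Notation S := {mpoly k[d + s]}.
Local Notation mon := 'X_{1..d + s}.
Let iI := hI.1.

(** Presentation of the Rees algebra of [I] with its parameter set to 1; the forgotten exponent of
    the parameter is recorded by [tdeg] below. *)
Definition rees_var (i : 'I_(d + s)) : R :=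
  match split i with inl i => 'X_i | inr j => g j end.

Definition rees_map (F : S) : R := mmap (@mpolyC d k) rees_var F.
Local Notation Phi := rees_map.

HB.instance Definition _ := GRing.RMorphism.copy rees_map (mmap (@mpolyC d k) rees_var).

Lemma rees_mapZ c F : Phi (c *: F) = c *: Phi F.
Proof. by rewrite /rees_map mmapZ mul_mpolyC. Qed.

Definition xpart (m : mon) : 'X_{1..d} := [multinom m (lshift s i) | i < d].
Definition tdeg (m : mon) : nat := \sum_j m (rshift d j).
(** The degree in [R] of the image of a monomial, since [g j] is homogeneous of degree [e j]. *)
Definition wdeg (m : mon) : nat := (mdeg (xpart m) + \sum_j m (rshift d j) * e j)%N.

Lemma tdegD m m' : tdeg (m + m')%MM = (tdeg m + tdeg m')%N.
Proof. by rewrite /tdeg -big_split; apply: eq_bigr => i _; rewrite mnmDE. Qed.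

Lemma xpartD m m' : xpart (m + m')%MM = (xpart m + xpart m')%MM.
Proof. by apply/mnmP => i; rewrite mnmDE !mnmE. Qed.

Lemma wdegD m m' : wdeg (m + m')%MM = (wdeg m + wdeg m')%N.
Proof.
rewrite /wdeg xpartD mdegD addnACA; congr (_ + _)%N.
by rewrite -big_split; apply: eq_bigr => i _; rewrite mnmDE mulnDl.
Qed.

Lemma rees_mapX m : Phi 'X_[m] = 'X_[xpart m] * \prod_j g j ^+ m (rshift d j).
Proof.
rewrite /rees_map mmapX /mmap1 big_split_ord /=; congr (_ * _).
  rewrite mpolyXE_id; apply: eq_bigr => i _.
  by rewrite /rees_var -[lshift _ _]/(unsplit (inl _)) unsplitK mnmE.
by apply: eq_bigr => j _; rewrite /rees_var -[rshift _ _]/(unsplit (inr _)) unsplitK.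
Qed.

Lemma ideal_pow_prod (T : Type) (r : seq T) (F : T -> R) (a : T -> nat) :
  (forall i, I (F i)) -> ideal_pow I (\sum_(i <- r) a i) (\prod_(i <- r) F i ^+ a i).
Proof.
move=> IF; elim: r => [|i r IH]; first by rewrite !big_nil; apply: ideal_pow0.
rewrite !big_cons; apply: ideal_powM => //.
elim: (a i) => [|b IHb]; first exact: ideal_pow0.
by rewrite exprS; apply: (@ideal_powM _ _ _ 1) => //; apply/ideal_pow1.
Qed.

Lemma rees_mapX_pow m b u : ideal_pow I b u -> ideal_pow I (tdeg m + b) (Phi 'X_[m] * u).
Proof.
move=> Iu; rewrite rees_mapX -mulrA; apply: (idealM (ideal_pow_ideal _ _)).
by apply: ideal_powM => //; apply: ideal_pow_prod.
Qed.

Lemma restr_prod_deg (T : Type) (r : seq T) (F : T -> R) (a : T -> nat) :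
  (forall i, hcomp (a i) (F i) = F i) ->
  hcomp (\sum_(i <- r) a i) (\prod_(i <- r) F i) = \prod_(i <- r) F i.
Proof.
move=> h; elim: r => [|i r IH].
  by rewrite !big_nil; apply: hcomp_id => m; rewrite msupp1 inE => /eqP->; rewrite mdeg0.
rewrite !big_cons hcompE; apply: (restr_id_mul (h i) IH) => m m' /eqP em /eqP em'.
by rewrite mdegD em em'.
Qed.

Lemma hcomp_rees_mapX m : hcomp (wdeg m) (Phi 'X_[m]) = Phi 'X_[m].
Proof.
rewrite rees_mapX hcompE; apply: (restr_id_mul (P := fun u => mdeg u == mdeg (xpart m))
   (P' := fun u => mdeg u == \sum_j m (rshift d j) * e j)%N) => [||u u' /eqP eu /eqP eu'].
- by rewrite restrX eqxx.
- apply: restr_prod_deg => j; apply: hcomp_id => u.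
  elim: (m _) u => [u|b IH u]; first by rewrite msupp1 inE => /eqP->; rewrite mdeg0.
  rewrite exprS mulSn => /msuppM_le /allpairsP [[v w] /= [/gdeg ev /IH ew ->]].
  by rewrite mdegD ev ew.
by rewrite mdegD eu eu'.
Qed.

Lemma rees_map_hcomp t F : Phi (restr (fun m => wdeg m == t) F) = hcomp t (Phi F).
Proof.
elim/mpolyind: F => [|c m p _ _ IH]; first by rewrite restr0 !raddf0 hcomp0.
rewrite restrD !raddfD /= hcompD -IH restrZ !rees_mapZ hcompZ restrX; congr (_ *: _ + _).
case: eqP => [<-|ne]; first by rewrite hcomp_rees_mapX.
rewrite raddf0 -hcomp_rees_mapX; apply/mpolyP => u; rewrite !mcoeff_hcomp mcoeff0.
by case: eqP => // e1; case: eqP => // e2; case: ne; rewrite -e1 -e2.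
Qed.

(** Liftable elements are closed under sums, and under products with [tdeg] adding up. It remains to
    lift [R] in degree 0 and [I] in degree 1. *)
Lemma rees_lift n f : ideal_pow I n f ->
  exists F, restr (fun m => tdeg m == n) F = F /\ Phi F = f.
Proof.
pose L n f := exists F, restr (fun m => tdeg m == n) F = F /\ Phi F = f.
have LM a b u v : L a u -> L b v -> L (a + b)%N (u * v).
  move=> [F [hF <-]] [G [hG <-]]; exists (F * G); rewrite rmorphM; split=> //.
  by apply: (restr_id_mul hF hG) => m m' /eqP em /eqP em'; rewrite tdegD em em'.
have LD a u v : L a u -> L a v -> L a (u + v).
  by move=> [F [hF <-]] [G [hG <-]]; exists (F + G); rewrite restrD hF hG raddfD.
have L0 a : L a 0 by exists 0; rewrite restr0 raddf0.
have LR u : L 0%N u.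
  elim/mpolyind: u => [|c m p _ _ IH] //; apply: LD => //.
  pose M : mon := [multinom match split i with inl i => m i | inr _ => 0%N end | i < d + s].
  have Ml i : M (lshift s i) = m i.
    by rewrite mnmE -[lshift _ _]/(unsplit (inl _)) unsplitK.
  have Mr j : M (rshift d j) = 0%N.
    by rewrite mnmE -[rshift _ _]/(unsplit (inr _)) unsplitK.
  exists (c *: 'X_[M]); rewrite restrZ restrX /tdeg big1 ?eqxx //; split=> //.
  rewrite rees_mapZ rees_mapX [X in _ * X]big1 ?mulr1 => [|j _]; last by rewrite Mr.
  by congr (_ *: 'X_[_]); apply/mnmP => i; rewrite mnmE Ml.
have LI u : I u -> L 1%N u.
  move=> /gen [h ->]; apply: (big_ind (L 1%N)) => // [a b|j _]; first exact: LD.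
  apply: (LM 0%N 1%N); first exact: LR.
  exists 'X_(rshift d j); rewrite restrX rees_mapX.
  have tU : forall j', U_(rshift d j)%MM (rshift d j') = (j == j') :> nat.
    by move=> j'; rewrite mnm1E eq_rshift.
  have -> : xpart U_(rshift d j) = 0%MM.
    by apply/mnmP => i; rewrite mnmE mnm0E mnm1E eq_rlshift.
  rewrite mpolyX0 mul1r /tdeg (bigD1 j) //= tU eqxx big1 => [|j' ne]; last first.
    by rewrite tU eq_sym (negPf ne).
  split=> //; rewrite (bigD1 j) //= tU eqxx big1 ?mulr1 // => j' ne.
  by rewrite tU eq_sym (negPf ne).
rewrite -/(L n f); move: f; apply: ideal_pow_ind => [|u v|r t It] //; first exact: LD.
apply: (LM 0%N n) => //; rewrite -{1}(size_tuple t).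
elim: (tval t) It => [|x r' IH] Ir; first by rewrite big_nil; apply: LR.
rewrite big_cons; apply: (LM 1%N (size r')); first by apply/LI/Ir; rewrite inE eqxx.
by apply: IH => y yr; apply: Ir; rewrite inE yr orbT.
Qed.

Local Notation bipred n t := (fun m : mon => (tdeg m == n) && (wdeg m == t)).

(* The preimage in S of H^0_m of the associated graded ring of I. *)
Definition gr_torsion (F : S) : Prop := forall n t, exists u, forall i : 'I_d,
  ideal_pow I n.+1 ('X_i ^+ u * Phi (restr (bipred n t) F)).

Lemma restr_bi_mulX n t m (F : S) : restr (bipred n t) ('X_[m] * F) =
  if (tdeg m <= n)%N && (wdeg m <= t)%N then
    'X_[m] * restr (bipred (n - tdeg m)%N (t - wdeg m)%N) F else 0.
Proof.
rewrite restr_mulX; case: ifP => [/andP [le1 le2]|h].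
  congr (_ * _); apply: restr_eq => m' /=; rewrite tdegD wdegD.
  by rewrite -(eqn_add2l (tdeg m) (tdeg m')) -(eqn_add2l (wdeg m) (wdeg m')) !subnKC.
rewrite (restr_eq (P' := pred0)) ?restr_pred0 ?mulr0 // => m'; apply/negbTE; move: h.
rewrite tdegD wdegD; apply: contraFN => /andP [/eqP<- /eqP<-].
by rewrite !leq_addr.
Qed.

Lemma gr_torsion_ideal : is_ideal gr_torsion.
Proof.
have iP n := ideal_pow_ideal I n.
have torD F G : gr_torsion F -> gr_torsion G -> gr_torsion (F + G).
  move=> hF hG n t; have [u hu] := hF n t; have [v hv] := hG n t.
  exists (maxn u v) => i; rewrite restrD raddfD mulrDr; apply: idealD => //.
    by apply: expX_le (hu i) => //; apply: leq_maxl.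
  by apply: expX_le (hv i) => //; apply: leq_maxr.
have tor0 : gr_torsion 0.
  by move=> n t; exists 0%N => i; rewrite restr0 raddf0 mulr0; apply: ideal0.
split=> //; split=> // r F hF; elim/mpolyind: r => [|c m p _ _ IH]; first by rewrite mul0r.
rewrite mulrDl; apply: torD => // n t; rewrite -scalerAl restrZ.
case: (boolP ((tdeg m <= n)%N && (wdeg m <= t)%N)) => h; last first.
  exists 0%N => i; rewrite restr_bi_mulX (negPf h) scaler0 raddf0 mulr0; exact: ideal0.
have [u hu] := hF (n - tdeg m)%N (t - wdeg m)%N; exists u => i.
rewrite rees_mapZ -scalerAr; apply: idealZ => //.
rewrite restr_bi_mulX h rmorphM mulrCA.
have -> : n.+1 = (tdeg m + (n - tdeg m).+1)%N by rewrite addnS subnKC //; case/andP: h.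
exact: rees_mapX_pow.
Qed.

(** The torsion ideal of [S] has finitely many generators, whose components have bidegrees below [B]
    and are killed by all $x_i^K$ modulo the next power of [I]. If [t] is large against [n], every
    monomial multiplying such a component contains some $x_i^K$, so the product lies in
    $I^{n+1}$. *)
Lemma gr_torsion_degree : exists c, forall n t f, ideal_pow I n f -> hcomp t f = f ->
  H0m_pre (ideal_pow I n.+1) f -> (c * n + c < t)%N -> ideal_pow I n.+1 f.
Proof.
have iP n := ideal_pow_ideal I n.
have [q [G [torG hG]]] := hilbert_basis gr_torsion_ideal.
pose B := (\max_(j < q) \max_(m <- msupp (G j)) maxn (tdeg m) (wdeg m)).+1.
have hB j m : m \in msupp (G j) -> (tdeg m < B)%N /\ (wdeg m < B)%N.
  move=> mG; rewrite /B !ltnS.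
  have le : (maxn (tdeg m) (wdeg m) <= \max_(j < q) \max_(m <- msupp (G j)) maxn (tdeg m) (wdeg m))%N.
    apply: leq_trans (leq_bigmax j).
    exact: (leq_bigmax_seq (F := fun m => maxn (tdeg m) (wdeg m)) m).
  by split; apply: leq_trans le; rewrite (leq_maxl, leq_maxr).
have [u hu] := fun_choice (fun x : 'I_q * 'I_B * 'I_B => torG x.1.1 x.1.2 x.2).
pose K := (\max_x u x)%N.
pose E := (\max_j e j)%N.
(* [B] pays for the weight of a generator, [d * K] for the pigeonhole on the [x] part, and [E] times
   [n] for at most [n] generator variables. *)
pose c := (B + d * K + E)%N.
exists c => n t f If hf Hf lt.
have [F0 [hF0 eF0]] := rees_lift If.
pose F := restr (fun m => wdeg m == t) F0.
have hF : restr (bipred n t) F = F.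
  rewrite -{2}/F /F -{2}hF0 !restr_restr; apply: restr_eq => m /=.
  by case: (tdeg m == n); case: (wdeg m == t).
have eF : Phi F = f by rewrite rees_map_hcomp eF0.
have torF : gr_torsion F.
  move=> n' t'; rewrite -hF restr_restr.
  case: (boolP ((n' == n) && (t' == t))) => [/andP [/eqP-> /eqP->]|ne].
    have /(H0m_preP _ d0 (iP _)) [v hv] := Hf; exists v => i.
    rewrite (restr_eq (P' := bipred n t)) ?hF ?eF // => m /=.
    by rewrite andbb.
  exists 0%N => i; rewrite (restr_eq (P' := pred0)) ?restr_pred0 ?raddf0 ?mulr0; first exact: ideal0.
  move=> m /=; apply/negbTE; apply: contra ne => /andP [/andP [/eqP-> /eqP->] /andP [/eqP-> /eqP->]].
  by rewrite !eqxx.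
have [h eh] := hG _ torF.
rewrite -eF -hF eh restr_sum raddf_sum; apply: ideal_sum => // j _.
rewrite /= (mpolyE (h j)) mulr_suml restr_sum raddf_sum; apply: ideal_sum => // m _.
rewrite -scalerAl restrZ /= rees_mapZ; apply: idealZ => //.
rewrite restr_bi_mulX; case: ifP => [/andP [len let']|_]; last by rewrite raddf0; apply: ideal0.
rewrite rmorphM /=.
case: (altP (restr (bipred (n - tdeg m)%N (t - wdeg m)%N) (G j) =P 0)) => [->|nz].
  by rewrite raddf0 mulr0; apply: ideal0.
have [m' m'G] : exists m', m' \in msupp (restr (bipred (n - tdeg m)%N (t - wdeg m)%N) (G j)).
  by exists (mlead (restr (bipred (n - tdeg m)%N (t - wdeg m)%N) (G j))); apply: mlead_supp.
move: m'G; rewrite mcoeff_msupp mcoeff_restr; case: ifP => [/andP [/eqP e1 /eqP e2]|]; last by rewrite eqxx.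
rewrite -mcoeff_msupp => /hB; rewrite e1 e2 => -[lt1 lt2].
have hE : (\sum_j m (rshift d j) * e j <= E * n)%N.
  apply: (@leq_trans (E * tdeg m)); last by rewrite leq_mul2l len orbT.
  rewrite /tdeg big_distrr /=; apply: leq_sum => a _.
  by rewrite mulnC leq_mul2r leq_bigmax orbT.
have hx : (d * K <= mdeg (xpart m))%N.
  rewrite -(leq_add2r (\sum_j m (rshift d j) * e j)) -/(wdeg m).
  apply: (@leq_trans (d * K + E * n)); first by rewrite leq_add2l.
  rewrite -(leq_add2l B); apply: (@leq_trans t); last first.
    by rewrite -leq_subLR leq_subCl; apply: ltnW.
  apply: leq_trans (ltnW lt); rewrite /c addnA addnC; apply: leq_add.
    by rewrite leq_mul2r leq_addl orbT.
  exact: leq_addr.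
have [i le] := pigeonhole_mnm d0 hx; rewrite mnmE in le.
have leM : (U_(lshift s i) *+ K <= m)%MM.
  by apply/mnm_lepP => a; rewrite mulmnE mnm1E; case: eqP => [<-|_]; rewrite ?mul1n ?mul0n.
have PX : Phi 'X_(lshift s i) = 'X_i.
  rewrite /rees_map mmapX mmap1U /rees_var -[lshift _ _]/(unsplit (inl _)) unsplitK //.
have tm : tdeg (m - U_(lshift s i) *+ K)%MM = tdeg m.
  rewrite -{2}(submK leM) tdegD [tdeg (_ *+ K)]big1 ?addn0 // => a _.
  by rewrite mulmnE mnm1E eq_lrshift.
rewrite -{1}(submK leM) mpolyXD -mpolyXn rmorphM rmorphXn /= PX -mulrA.
(* Removing the power of $x_i$ leaves [tdeg] unchanged, so the one extra power of [I] comes from the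
   killed component of [G j]. *)
have -> : n.+1 = (tdeg (m - U_(lshift s i) *+ K)%MM + (n - tdeg m).+1)%N.
  by rewrite tm addnS subnKC.
apply: rees_mapX_pow.
apply: expX_le (hu (j, Ordinal lt1, Ordinal lt2) i) => //.
exact: leq_bigmax.
Qed.

End LinearBound.

Section LinearBoundHomog.
Variables (k : fieldType) (d : nat).
Hypothesis d0 : (0 < d)%N.
Local Notation R := {mpoly k[d]}.
Variables (I : R -> Prop) (hI : is_homog_ideal I).

(** Climb the powers of [I]: an element of $I^j$, $j < n$, that is torsion modulo $I^n$ is torsion
    modulo $I^{j+1}$, so the bound for the associated graded ring moves it into $I^{j+1}$. *)
Lemma saturation_degree : exists c, forall n t f, H0m_pre (ideal_pow I n) f -> hcomp t f = f ->
  (c * n + c < t)%N -> ideal_pow I n f.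
Proof.
have [iI hh] := hI.
have [p [g0 [Ig0 hg0]]] := hilbert_basis iI.
pose N := (\max_i msize (g0 i))%N.
(* The generators are replaced by all their homogeneous components, indexed by a generator and a
   degree below [N]. *)
pose s := #|{: 'I_p * 'I_N}|.
pose g (j : 'I_s) : R := hcomp (enum_val j).2 (g0 (enum_val j).1).
have Ig j : I (g j) by apply: hh.
have gen f : I f -> exists h : 'I_s -> R, f = \sum_j h j * g j.
  move=> /hg0 [h ->]; exists (fun j => h (enum_val j).1).
  rewrite /g -(big_enum_val (fun x : 'I_p * 'I_N => h x.1 * hcomp x.2 (g0 x.1))) -(pair_bigA _ (fun (i : 'I_p) (j : 'I_N) => h i * hcomp j (g0 i))) /=.
  apply: eq_bigr => i _; rewrite -mulr_sumr; congr (_ * _).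
  rewrite {1}(sum_hcomp (g0 i)) (big_ord_widen N (fun j => hcomp j (g0 i))); last exact: leq_bigmax.
  rewrite big_mkcond; apply: eq_bigr => j _; case: ltnP => // le.
  apply/mpolyP => m; rewrite mcoeff0 mcoeff_hcomp; case: eqP => // em.
  by rewrite memN_msupp_eq0 // msize_mdeg_ge // em.
have gdeg j m : m \in msupp (g j) -> mdeg m = (enum_val j).2.
  by rewrite mcoeff_msupp mcoeff_hcomp; case: (altP (mdeg m =P _)) => // _; rewrite eqxx.
have [c hc] := gr_torsion_degree d0 hI Ig gen gdeg.
exists c => n t f Hf hf lt.
suff : forall j, (j <= n)%N -> ideal_pow I j f by apply.
elim=> [_|j IH ltj]; first exact: ideal_pow0.
apply: (hc _ t) => //.
- by apply: IH; apply: ltnW.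
- move: Hf; case=> u hu; exists u => v /hu; move: {IH hu lt} ltj; elim: n => // n IHn.
  by rewrite ltnS leq_eqVlt => /orP [/eqP->|/IHn h] // /ideal_powS.
by apply: leq_ltn_trans lt; rewrite leq_add2r leq_mul2l ltnW ?orbT.
Qed.
End LinearBoundHomog.

(** * Existence of the limit *)

Section RealLimits.
Import Reals Lra.
Local Open Scope R_scope.

Lemma INR_expn (a b : nat) : INR (expn a b) = INR a ^ b.
Proof. by elim: b => [|b IH] //; rewrite expnS mult_INR IH. Qed.

Lemma bernoulli_sub (x : R) (n : nat) : 0 <= x <= 1 -> 1 - INR n * x <= (1 - x) ^ n.
Proof.
move=> hx; elim: n => [|n IH]; first by rewrite /=; lra.
rewrite S_INR /=; have := Rmult_le_compat_l (1 - x) _ _ ltac:(lra) IH.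
have := pos_INR n; nra.
Qed.

(** The limit is the supremum of the $s(n)/n^d$ over positive [n]. Writing $n = qN + r$ gives
    $s(n)/n^d \ge (s(N)/N^d)(qN/n)^d$, and Bernoulli's inequality bounds $(qN/n)^d$ below by $1 -
    dN/n$. *)
Lemma cube_superadditive_cv (d C : nat) (s : nat -> nat) :
  (forall N q r, leq (muln (expn q d) (s N)) (s (addn (muln q N) r))) ->
  (forall n, leq (s n) (muln (expn C d) (expn n d))) -> exists L, Un_cv (normseq s d) L.
Proof.
move=> sup bd.
have npow n : leq 1 n -> 0 < INR n ^ d.
  by move=> /ssrnat.ltP n0; apply: pow_lt; apply: lt_0_INR.
have bdR n : leq 1 n -> normseq s d n <= INR C ^ d.
  move=> n0; rewrite /normseq; apply: (Rmult_le_reg_r (INR n ^ d)); first exact: npow.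
  rewrite /Rdiv Rmult_assoc Rinv_l; last by have := npow n n0; lra.
  by rewrite Rmult_1_r -!INR_expn -mult_INR; apply/le_INR/ssrnat.leP/bd.
pose E x := exists n, leq 1 n /\ x = normseq s d n.
have [L [Lub Lleast]] : {L | is_lub E L}.
  apply: completeness; first by exists (INR C ^ d) => x [n [n0 ->]]; apply: bdR.
  by exists (normseq s d 1), (S O).
exists L => eps eps0.
have [N [N0 hN]] : exists N, leq 1 N /\ L - eps / 2 < normseq s d N.
  apply: NNPP => h.
  have : L <= L - eps / 2; last by lra.
  by apply: Lleast => x [n [n0 ->]]; apply: Rnot_lt_le => lt; apply: h; exists n.
have N0R : 0 < INR N by apply/lt_0_INR/ssrnat.ltP.
(* Beyond [K] the loss $dN/n$, multiplied by the bound $C^d$, is below [eps / 2]. *)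
pose K := 2 * (INR C ^ d * INR d * INR N) / eps.
have [n0 hn0] := INR_unbounded K.
exists (addn n0 N) => n /ssrnat.leP len.
have Nn : leq N n by apply: leq_trans len; rewrite leq_addl.
have n_gt0 : leq 1 n by apply: leq_trans Nn.
have nR : 0 < INR n by apply/lt_0_INR/ssrnat.ltP.
have up : normseq s d n <= L by apply: Lub; exists n.
have Kn : K < INR n.
  by apply: Rlt_le_trans hn0 _; apply/le_INR/ssrnat.leP; apply: leq_trans len; rewrite leq_addr.
have lo : normseq s d N * (1 - INR d * (INR N / INR n)) <= normseq s d n.
  pose q := (divn n N).
  have hq : 1 - INR N / INR n <= INR q * INR N / INR n.
    apply: (Rmult_le_reg_r (INR n)) => //.
    have e1 : INR N / INR n * INR n = INR N by field; lra.
    have e2 : INR q * INR N / INR n * INR n = INR q * INR N by field; lra.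
    rewrite e2 Rmult_minus_distr_r e1 Rmult_1_l.
    have := divn_eq n N; rewrite -/q => e.
    have : INR n = INR q * INR N + INR (modn n N) by rewrite {1}e plus_INR mult_INR.
    have : INR (modn n N) <= INR N by apply/le_INR/ssrnat.leP/ltnW/ltn_pmod.
    lra.
  have hx : 0 <= INR N / INR n <= 1.
    split; first by apply: Rlt_le; apply: Rdiv_lt_0_compat.
    apply: (Rmult_le_reg_r (INR n)) => //; rewrite /Rdiv Rmult_assoc Rinv_l; last lra.
    by rewrite Rmult_1_r Rmult_1_l; apply/le_INR/ssrnat.leP.
  have h1 : 1 - INR d * (INR N / INR n) <= (INR q * INR N / INR n) ^ d.
    apply: Rle_trans (bernoulli_sub d hx) _; apply: pow_incr; lra.
  have sN0 : 0 <= normseq s d N.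
    apply: Rmult_le_pos; first exact: pos_INR.
    by apply/Rlt_le/Rinv_0_lt_compat/npow.
  apply: Rle_trans (Rmult_le_compat_l _ _ _ sN0 h1) _.
  rewrite /normseq (_ : INR (s N) / INR N ^ d * (INR q * INR N / INR n) ^ d =
     INR q ^ d * INR (s N) / INR n ^ d); last first.
    rewrite /Rdiv !Rpow_mult_distr pow_inv; field.
    by split; apply: Rgt_not_eq; apply: npow.
  apply: Rmult_le_compat_r; first by apply/Rlt_le/Rinv_0_lt_compat/npow.
  rewrite -INR_expn -mult_INR; apply/le_INR/ssrnat.leP.
  by rewrite {1}(divn_eq n N); apply: sup.
rewrite /R_dist /Rdist; apply: Rabs_def1; first lra.
have bN := bdR _ N0.
have small : normseq s d N * (INR d * (INR N / INR n)) < eps / 2.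
  apply: (@Rle_lt_trans _ (INR C ^ d * INR d * INR N / INR n)).
    rewrite (_ : INR C ^ d * INR d * INR N / INR n = INR C ^ d * (INR d * (INR N / INR n))); last by field; lra.
    apply: Rmult_le_compat_r => //; apply: Rmult_le_pos; first exact: pos_INR.
    by apply: Rlt_le; apply: Rdiv_lt_0_compat.
  apply: (Rmult_lt_reg_r (INR n)) => //.
  rewrite /Rdiv Rmult_assoc Rinv_l ?Rmult_1_r; last lra.
  have : K * eps < INR n * eps by apply: Rmult_lt_compat_r.
  rewrite (_ : K * eps = 2 * (INR C ^ d * INR d * INR N)); last by rewrite /K; field; lra.
  lra.
lra.
Qed.

Lemma normseq_sub_cv (d : nat) (a s s' : nat -> nat) L L' :
  (forall n, s' n = addn (s n) (a n)) -> Un_cv (normseq s d) L -> Un_cv (normseq s' d) L' ->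
  exists l, Un_cv (normseq a d) l.
Proof.
move=> e cs cs'; exists (L' - L); have := CV_minus _ _ _ _ cs' cs; apply: Un_cv_ext => n.
by rewrite /normseq e plus_INR /Rdiv; ring.
Qed.

Lemma normseq0_cv (d : nat) : Un_cv (normseq (fun _ => O) d) 0.
Proof.
move=> eps eps0; exists O => n _; rewrite /normseq /Rdiv Rmult_0_l /R_dist /Rdist Rminus_0_r Rabs_R0 //.
Qed.

End RealLimits.

Definition asb (P : Prop) : bool := if excluded_middle_informative P then true else false.

Lemma asbP P : reflect P (asb P).
Proof. by rewrite /asb; case: excluded_middle_informative => h; constructor. Qed.

(** * Counting monomials in boxes *)

Section MonomialFamilies.
Variable d : nat.
Implicit Types (m p : 'X_{1..d}).

Definition box_mnm B (x : {ffun 'I_d -> 'I_B}) : 'X_{1..d} := [multinom (x i : nat) | i < d].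

Lemma box_mnm_inj B : injective (@box_mnm B).
Proof. by move=> x y /mnmP h; apply/ffunP => i; apply: val_inj; have := h i; rewrite !mnmE. Qed.

Definition box_count (C : nat) (M : nat -> 'X_{1..d} -> Prop) (n : nat) : nat :=
  #|[set x : {ffun 'I_d -> 'I_(C * n)} | asb (M n (box_mnm x))]|.

(* The cubes q m + r p + [0, q)^d, for m in M N, are disjoint and lie in M (q N + r). *)
Lemma box_count_superadditive C (M : nat -> 'X_{1..d} -> Prop) p :
  (0 < d)%N -> M 0%N 0%MM -> (forall n m m', M n m -> (m <= m')%MM -> M n m') ->
  (forall a b u v, M a u -> M b v -> M (a + b)%N (u + v)%MM) ->
  M 1%N p -> (forall i, p i <= C)%N ->
  forall N q r, (q ^ d * box_count C M N <= box_count C M (q * N + r))%N.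
Proof.
move=> d0 M0 Mup MD Mp pC N [|q'] r; first by rewrite exp0n.
set q := q'.+1.
have Mn b u : M b u -> forall j, M (j * b)%N (u *+ j)%MM.
  move=> Mu; elim=> [|j IH]; first by rewrite mulm0n.
  by rewrite mulmS; apply: MD.
have lt (x : {ffun 'I_d -> 'I_(C * N)}) (w : {ffun 'I_d -> 'I_q}) i :
    (q * x i + r * p i + w i < C * (q * N + r))%N.
  rewrite addnAC mulnDr [(C * r)%N]mulnC -addSn; apply: leq_add; last by rewrite leq_mul2l pC orbT.
  apply: (@leq_trans (q * (x i).+1)); first by rewrite mulnS addnC ltn_add2r.
  by rewrite mulnCA leq_mul2l ltn_ord orbT.
pose F (y : {ffun 'I_d -> 'I_(C * N)} * {ffun 'I_d -> 'I_q}) :=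
  [ffun i => Ordinal (lt y.1 y.2 i)].
have Finj : injective F.
  move=> [x w] [x' w'] /ffunP h.
  have h' i : (q * x i + w i)%N = (q * x' i + w' i)%N.
    move: (h i); rewrite !ffunE => /(congr1 val) /=; rewrite ![(_ + r * _ + _)%N]addnAC.
    by move=> /addIn.
  congr (_, _); apply/ffunP => i; apply: val_inj => /=.
    have := congr1 (divn^~ q) (h' i); rewrite /= ![(q * _)%N]mulnC !divnMDl //.
    by rewrite !divn_small ?addn0.
  have := congr1 (modn^~ q) (h' i); rewrite /= ![(q * _)%N]mulnC !modnMDl.
  by rewrite !modn_small.
rewrite /box_count; set S := [set x | _]; set S' := [set x | _].
have -> : (q ^ d * #|S|)%N = #|setX S [set: {ffun 'I_d -> 'I_q}]|.
  by rewrite cardsX cardsT card_ffun !card_ord mulnC.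
rewrite -(card_imset _ Finj); apply: subset_leq_card; apply/subsetP => z.
case/imsetP => -[x w]; rewrite !inE andbT => /asbP Mx ->; apply/asbP.
apply: (Mup _ (box_mnm x *+ q + p *+ r)%MM).
  by apply: MD; [apply: Mn | rewrite -[X in M X]muln1; apply: Mn].
apply/mnm_lepP => i; rewrite mnmDE !mulmnE !mnmE ffunE /=.
by rewrite [(x i * q)%N]mulnC [(p i * r)%N]mulnC leq_addr.
Qed.

Lemma box_count_le C M n : (box_count C M n <= C ^ d * n ^ d)%N.
Proof.
rewrite -expnMn; apply: leq_trans (max_card _) _.
by rewrite card_ffun !card_ord.
Qed.

End MonomialFamilies.

(** * The limit for the saturations of the powers *)

Section SaturationLength.
Variables (k : fieldType) (d : nat).
Hypothesis d0 : (0 < d)%N.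
Local Notation R := {mpoly k[d]}.
Variables (I : R -> Prop) (hI : is_homog_ideal I).
Local Notation J n := (ideal_pow I n).
Local Notation J' n := (H0m_pre (ideal_pow I n)).

Lemma lead_set_family (K : nat -> R -> Prop) :
  (forall n, is_ideal (K n)) -> (forall a b f g, K a f -> K b g -> K (a + b)%N (f * g)) ->
  (forall n m m', lead_set (K n) m -> (m <= m')%MM -> lead_set (K n) m') /\
  (forall a b u v, lead_set (K a) u -> lead_set (K b) v -> lead_set (K (a + b)%N) (u + v)%MM).
Proof.
move=> iK KM; split=> [n m m' [f [Kf f0 <-]] le|a b u v [f [Kf f0 <-]] [g [Kg g0 <-]]].
  have X0 : 'X_[m' - mlead f] != 0 :> R.
    by rewrite -mleadc_eq0 mleadXm mcoeffX eqxx oner_eq0.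
  exists ('X_[m' - mlead f] * f); rewrite mulf_neq0 // mleadM // mleadXm submK //; split=> //.
  exact: idealM.
by exists (f * g); rewrite mulf_neq0 // mleadM //; split=> //; apply: KM.
Qed.

(** Replace [f] by its component in the degree of its leading monomial, which keeps that monomial;
    in high degree this component would lie in $I^n$. For [n = 0] the ideal is all of [R], so no
    monomial is missing. *)
Lemma lead_set_saturation : exists c, forall n m, lead_set (J' n) m -> ~ lead_set (J n) m ->
  (0 < n)%N /\ (mdeg m <= c * n + c)%N.
Proof.
have [c hc] := saturation_degree d0 hI; exists c => n m [f [J'f f0 em]] nJ; split.
  rewrite lt0n; apply: contra_notN nJ => /eqP->; exists f; split=> //; exact: ideal_pow0.
rewrite leqNgt; apply: contra_notN nJ => lt.
pose f' := hcomp (mdeg m) f.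
have cf' : f'@_m = f@_m by rewrite mcoeff_hcomp eqxx.
have f'0 : f' != 0.
  by apply/eqP => e; move: cf'; rewrite e mcoeff0 -em => /esym/eqP; rewrite mleadc_eq0 (negPf f0).
exists f'; split=> //.
  apply: (hc _ (mdeg m)) => //.
    exact: (H0m_pre_homog d0 (ideal_pow_homog n hI)).2.
  by apply/mpolyP => u; rewrite !mcoeff_hcomp; case: eqP.
apply/eqP; rewrite eq_le; apply/andP; split; last first.
  by apply: msupp_le_mlead; rewrite mcoeff_msupp cf' -em mleadc_eq0.
rewrite -em; apply: msupp_le_mlead; have := mlead_supp f'0.
by rewrite !mcoeff_msupp {1}/f' mcoeff_hcomp; case: ifP => // _; rewrite eqxx.
Qed.

Lemma saturation_kdim_cv : exists (a : nat -> nat) (L : Rdefinitions.R),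
  (forall n, kdim (V := R^o) (J n) (J' n) (a n)) /\ Rseries.Un_cv (normseq a d) L.
Proof.
have iJ n := ideal_pow_ideal I n.
have iJ' n := H0m_pre_ideal d0 (iJ n).
have sub n f : J n f -> J' n f by apply: sub_H0m_pre.
(* The zero ideal has no leading monomial [p] to start from, but then each $I^n$ is its own
   saturation. *)
case: (classic (exists f, I f /\ f != 0)) => [[f1 [If1 f10]]|I0]; last first.
  exists (fun _ => 0%N), Rdefinitions.R0; split; last exact: normseq0_cv.
  have {}I0 f : I f -> f = 0.
    by move=> If; apply/eqP; apply: contraT => f0; case: I0; exists f.
  move=> n; exists (fun _ => 0); split; first by case.
  split; last by move=> a _ [].
  move=> f J'f; exists (fun _ => 0); rewrite /comb big_ord0 subr0.
  case: n J'f => [|n]; first by move=> _; apply: ideal_pow0.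
  have J0 g : J n.+1 g -> g = 0.
    move: g; apply: (ideal_pow_ind (Q := fun g => g = 0)) => [|u v -> ->|r t It]; rewrite ?addr0 //.
    have e : thead t = 0 by apply: I0; apply: It; apply: mem_tnth.
    by rewrite (tuple_eta t) big_cons e mul0r mulr0.
  move=> /(H0m_preP _ d0 (iJ _)) [t /(_ (Ordinal d0)) /J0 /eqP].
  rewrite mulf_eq0 expf_eq0 => /orP [/andP [_ /eqP e]|/eqP->]; last exact: ideal0.
  by have := mcoeffXU k (Ordinal d0) (Ordinal d0); rewrite e mcoeff0 eqxx => /esym/eqP; rewrite oner_eq0.
have [c hc] := lead_set_saturation.
pose p := mlead f1.
(* [C] must bound the coordinates of [p] for superadditivity, and satisfy $cn + c < Cn$ for positive
   [n], so that the box contains all monomials to be counted. *)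
pose C := (\max_i p i + (c + c).+1)%N.
have pC i : (p i <= C)%N by apply: leq_trans (leq_addr _ _); apply: leq_bigmax.
pose M n := lead_set (J n); pose M' n := lead_set (J' n).
have MM' n m : M n m -> M' n m by move=> [f [Jf f0 e]]; exists f; split=> //; apply: sub.
have M0 : M 0%N 0%MM by exists 1; rewrite oner_eq0 mlead1; split=> //; apply: ideal_pow0.
have Mp : M 1%N p by exists f1; split=> //; apply/ideal_pow1 => //; case: hI.
have [Mup MD] := lead_set_family iJ (@ideal_powM k d I).
have [M'up M'D] := lead_set_family iJ' (@H0m_preM k d d0 I).
have [L hL] := cube_superadditive_cv (box_count_superadditive d0 M0 Mup MD Mp pC) (box_count_le C M).
have [L' hL'] := cube_superadditive_cv
  (box_count_superadditive d0 (MM' _ _ M0) M'up M'D (MM' _ _ Mp) pC) (box_count_le C M').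
pose D n := [set x : {ffun 'I_d -> 'I_(C * n)} | asb (M' n (box_mnm x))] :\:
            [set x : {ffun 'I_d -> 'I_(C * n)} | asb (M n (box_mnm x))].
pose a n := #|D n|.
have [l hl] : exists l, Rseries.Un_cv (normseq a d) l.
  apply: (normseq_sub_cv _ hL hL') => n.
  rewrite /a /D cardsD (setIidPr _) ?subnKC //; try (apply: subset_leq_card);
  by apply/subsetP => x; rewrite !inE => /asbP Mx; apply/asbP/MM'.
exists a, l; split=> // n; rewrite /a cardE -(size_map (@box_mnm d (C * n))).
apply: kdim_lead_set => //; first exact: sub.
  by rewrite map_inj_uniq ?enum_uniq //; apply: box_mnm_inj.
move=> m; split=> [/mapP [x]|[M'm nMm]].
  by rewrite mem_enum !inE => /andP [/asbP ? /asbP ?] ->.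
have [n0 le] := hc _ _ M'm nMm.
have lt i : (m i < C * n)%N.
  apply: (@leq_ltn_trans (mdeg m)); first by rewrite mdegE (bigD1 i) //= leq_addr.
  apply: leq_ltn_trans le _; apply: (@leq_ltn_trans ((c + c) * n)).
    by rewrite mulnDl leq_add2l leq_pmulr.
  by rewrite ltn_mul2r n0 /C ltn_addl.
apply/mapP; exists [ffun i => Ordinal (lt i)].
  rewrite mem_enum !inE; have -> : box_mnm [ffun i => Ordinal (lt i)] = m.
    by apply/mnmP => i; rewrite mnmE ffunE.
  by apply/andP; split; apply/asbP.
by apply/mnmP => i; rewrite mnmE ffunE.
Qed.

End SaturationLength.

Lemma kdim_ext (k : fieldType) (d : nat) (V : lmodType {mpoly k[d]}) (N P N' P' : V -> Prop) l :
  (forall v, N v <-> N' v) -> (forall v, P v <-> P' v) -> kdim N P l -> kdim N' P' l.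
Proof.
move=> eN eP [b [Pb [span ib]]]; exists b; split; first by move=> i; apply/eP.
split=> [v /eP /span [a Na]|a /eN]; last exact: ib.
by exists a; apply/eN.
Qed.

(** * Resolutions modulo powers of the variables *)

Section PowerIdeals.
Variables (k : fieldType) (d t : nat).
Local Notation R := {mpoly k[d]}.

(* The ideal q_j generated by the t-th powers of the first j variables. *)
Definition power_ideal (j : nat) (f : R) : Prop :=
  forall m : 'X_{1..d}, (forall i : 'I_d, (i < j)%N -> (m i < t)%N) -> f@_m = 0.

Lemma power_ideal_ideal j : is_ideal (power_ideal j).
Proof.
split; first by move=> m _; rewrite mcoeff0.
split=> [a b qa qb m hm|r a qa m hm]; first by rewrite mcoeffD qa // qb // addr0.
rewrite mcoeffM big1 // => -[[u hu] [v hv]] /= {hu hv} /eqP e.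
rewrite (qa v) ?mulr0 // => i ij; apply: leq_ltn_trans (hm i ij).
by rewrite e mnmDE leq_addl.
Qed.

Lemma power_ideal0 f : power_ideal 0 f -> f = 0.
Proof. by move=> qf; apply/mpolyP => m; rewrite mcoeff0 qf. Qed.

Lemma power_ideal_le j j' f : (j <= j')%N -> power_ideal j f -> power_ideal j' f.
Proof. by move=> le qf m hm; apply: qf => i ij; apply: hm; apply: leq_trans le. Qed.

Lemma power_ideal_exp j (i : 'I_d) f : (i < j)%N -> power_ideal j ('X_i ^+ t * f).
Proof.
move=> ij; rewrite mulrC; apply: (idealM (power_ideal_ideal j)).
move=> m hm; rewrite mpolyXn mcoeffX; case: eqP => // e.
by have := hm i ij; rewrite -e mulmnE mnm1E eqxx mul1n ltnn.
Qed.

(** Separate the terms of [f] by divisibility by $x_j^t$. Indices start at 0, so $x_j$ is the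
    variable that joins at [j.+1]. *)
Lemma power_ideal_split (j : 'I_d) f : power_ideal j.+1 f ->
  exists a b, power_ideal j a /\ f = a + 'X_j ^+ t * b.
Proof.
move=> qf; exists (restr (fun m => m j < t)%N f).
exists (\sum_(m <- msupp f | (t <= m j)%N) f@_m *: 'X_[m - U_(j) *+ t]); split.
  move=> m hm; rewrite mcoeff_restr; case: ifP => // mj; apply: qf => i.
  rewrite ltnS leq_eqVlt => /orP [/eqP/val_inj->|] //; exact: hm.
rewrite {1}(mpolyE f) (bigID (fun m : 'X_{1..d} => (m j < t)%N)) /=; congr (_ + _).
rewrite mulr_sumr; under eq_bigl do rewrite -leqNgt.
apply: eq_bigr => m le; rewrite -scalerAr mpolyXn -mpolyXD addmC submK //.
by apply/mnm_lepP => i; rewrite mulmnE mnm1E; case: eqP => [<-|_]; rewrite ?mul1n ?mul0n.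
Qed.

(** $q_j$ is generated by monomials in the variables before $x_j$, so multiplying by $x_j^t$ cannot
    bring a new term into it. *)
Lemma power_ideal_regular (j : 'I_d) f : power_ideal j ('X_j ^+ t * f) -> power_ideal j f.
Proof.
move=> qf m hm; rewrite -(mcoeffMX f (U_(j) *+ t)) mulrC -mpolyXn; apply: qf => i ij.
rewrite mnmDE mulmnE mnm1E; case: eqP => [e|_]; last by rewrite mul0n add0n hm.
by move: ij; rewrite -e ltnn.
Qed.

(* The socle generator of R/(x_1^t, ..., x_d^t); taking its coefficient makes this ring self-dual. *)
Definition top_mnm : 'X_{1..d} := [multinom t.-1 | i < d].

(** A monomial outside $q_d$ divides the top monomial, and multiplying by the complementary monomial
    moves its coefficient there. *)
Lemma power_ideal_residue f : (0 < t)%N ->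
  (power_ideal d f <-> forall g, (g * f)@_top_mnm = 0).
Proof.
move=> t0; split=> [qf g|h m hm].
  have /(_ top_mnm) := (power_ideal_ideal d).2.2 g f qf; apply=> i _.
  by rewrite mnmE prednK.
have le : (m <= top_mnm)%MM.
  by apply/mnm_lepP => i; rewrite mnmE -ltnS prednK // hm.
by rewrite -(h 'X_[top_mnm - m]) mulrC -{1}(submK le) mcoeffMX.
Qed.

Section Matrices.
Variables (n p : nat).
Implicit Types A B : 'M[R]_(n, p).

Definition power_mx j A : Prop := forall a b, power_ideal j (A a b).

Lemma power_mx_submod j : is_submod (power_mx j).
Proof.
have iq := power_ideal_ideal j.
split=> [a b|c A B qA qB a b]; first by rewrite mxE; apply: ideal0.
by rewrite !mxE; apply: (idealD iq) => //; apply: (idealM iq).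
Qed.

Lemma power_mx0 A : power_mx 0 A -> A = 0.
Proof. by move=> qA; apply/matrixP => a b; rewrite mxE; apply/power_ideal0/qA. Qed.

Lemma power_mx_le j j' A : (j <= j')%N -> power_mx j A -> power_mx j' A.
Proof. by move=> le qA a b; apply: power_ideal_le (qA a b). Qed.

Lemma power_mx_exp j (i : 'I_d) A : (i < j)%N -> power_mx j ('X_i ^+ t *: A).
Proof. by move=> ij a b; rewrite mxE; apply: power_ideal_exp. Qed.

Lemma power_mx_split (j : 'I_d) A : power_mx j.+1 A ->
  exists A' B, power_mx j A' /\ A = A' + 'X_j ^+ t *: B.
Proof.
move=> qA.
have h (x : 'I_n * 'I_p) : exists y : R * R, power_ideal j y.1 /\ A x.1 x.2 = y.1 + 'X_j ^+ t * y.2.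
  by have [a [b [? ?]]] := power_ideal_split (qA x.1 x.2); exists (a, b).
have [y hy] := fun_choice h.
exists (\matrix_(a, b) (y (a, b)).1), (\matrix_(a, b) (y (a, b)).2); split.
  by move=> a b; rewrite mxE; case: (hy (a, b)).
by apply/matrixP => a b; rewrite !mxE; case: (hy (a, b)).
Qed.

Lemma power_mx_regular (j : 'I_d) A : power_mx j ('X_j ^+ t *: A) -> power_mx j A.
Proof. by move=> qA a b; apply: power_ideal_regular; have := qA a b; rewrite mxE. Qed.

End Matrices.

Lemma power_mx_mull j n p q (A : 'M[R]_(n, p)) (B : 'M[R]_(p, q)) :
  power_mx j B -> power_mx j (A *m B).
Proof.
move=> qB a b; rewrite mxE; apply: (ideal_sum (power_ideal_ideal j)) => c _.
exact: (idealM (power_ideal_ideal j)).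
Qed.

Lemma power_mx_mulr j n p q (A : 'M[R]_(n, p)) (B : 'M[R]_(p, q)) :
  power_mx j A -> power_mx j (A *m B).
Proof.
move=> qA a b; rewrite mxE; apply: (ideal_sum (power_ideal_ideal j)) => c _.
by rewrite mulrC; apply: (idealM (power_ideal_ideal j)).
Qed.

End PowerIdeals.

(** * Homology of a resolution modulo the ideals $q_j$ *)

Section Resolution.
Variables (k : fieldType) (d t : nat).
Local Notation R := {mpoly k[d]}.
Variables (J : R -> Prop) (r : nat -> nat) (D : forall i, 'M[R]_(r i.+1, r i)).
Variable (c : 'cV[R]_(r 0%N)).
Hypothesis iJ : is_ideal J.
Hypothesis res : free_resolution J D c.
Local Notation qm := (@power_mx k d t _ _).

Lemma resolution_complex i n (A : 'M_(n, r i.+2)) : A *m D i.+1 *m D i = 0.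
Proof.
case: res => _ [_ ex]; apply/row_matrixP => a; rewrite !row_mul row0.
by apply/ex; exists (row a A).
Qed.

(* Degree-i cycles and boundaries of F/q_j F. *)
Definition cycle_mod i j : 'rV[R]_(r i) -> Prop :=
  match i return 'rV[R]_(r i) -> Prop with
  | 0%N => fun _ => True
  | i'.+1 => fun v => power_mx t j (v *m D i')
  end.

Definition bound_mod i j (v : 'rV[R]_(r i)) : Prop :=
  exists w : 'rV[R]_(r i.+1), power_mx t j (v - w *m D i).

Lemma bound_mod_submod i j : is_submod (@bound_mod i j).
Proof.
have [q0 qS] := @power_mx_submod k d t 1 (r i) j.
split=> [|a u v [w qw] [w' qw']]; first by exists 0; rewrite mul0mx subr0.
exists (a *: w + w').
have -> : a *: u + v - (a *: w + w') *m D i = a *: (u - w *m D i) + (v - w' *m D i).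
  by rewrite mulmxDl scalerBr -scalemxAl opprD addrACA.
exact: (qS a _ _ qw qw').
Qed.

Lemma bound_mod_power i j v : power_mx t j v -> @bound_mod i j v.
Proof. by move=> qv; exists 0; rewrite mul0mx subr0. Qed.

Lemma cycle_mod_quotient (j : 'I_d) i (v : 'rV_(r i.+1)) w :
  qm j (v *m D i - 'X_j ^+ t *: w) -> @cycle_mod i j w.
Proof.
case: i v w => [|i] v w // q; apply: (@power_mx_regular _ _ _ _ _ j).
have sq := @power_mx_submod k d t 1 (r i) j.
rewrite -[_ *: _]opprK; apply: (submodN sq).
have := power_mx_mulr (D i) q; rewrite mulmxBl resolution_complex sub0r -scalemxAl.
exact.
Qed.

(** Vanishing of $\operatorname{Tor}_i(R/J, R/q_j)$ for $i > j$, from the exact sequence of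
    multiplication by $x_j^t$: the quotient [w] of the differential of [v] is itself a boundary, and
    its preimage [u] corrects [v] to a cycle modulo $q_j$. *)
Lemma resolution_mod_exact j i : (j < i)%N -> (j <= d)%N ->
  forall v, @cycle_mod i j v -> @bound_mod i j v.
Proof.
elim: j i => [|j IH] [|i] //= lt led v cv.
  case: res => _ [_ ex]; have /ex [w ->] := power_mx0 cv.
  by exists w; rewrite subrr; apply: (submod_subspace (@power_mx_submod k d t _ _ _)).1.
pose jj : 'I_d := Ordinal led.
have [a [w [qa e]]] := @power_mx_split _ _ _ _ _ jj _ cv.
have sq := @power_mx_submod k d t 1 (r i) j.
have [u qu] : bound_mod j w.
  apply: IH => //; first exact: ltnW.
  by apply: (@cycle_mod_quotient jj _ v); rewrite e addrK.
have [w' qw'] : @bound_mod i.+1 j (v - 'X_jj ^+ t *: u).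
  apply: IH; [exact: ltnW | exact: ltnW | rewrite /cycle_mod].
  rewrite mulmxBl e -scalemxAl -addrA -scalerBr; apply: (submodD sq) => //.
  exact: (submodZ sq).
exists w'; rewrite -(subrK ('X_jj ^+ t *: u) v) addrAC.
apply: (submodD (@power_mx_submod k d t _ _ _)).
  by apply: power_mx_le qw'.
exact: power_mx_exp.
Qed.

(** Interpolates between the two ends of the identification: modulo boundaries it is $(J : q_d)/J$
    for [j = 0] and all of $H_d(F/q_d F)$ for [j = d]. *)
Definition tor_cycle j (v : 'rV[R]_(r j)) : Prop :=
  cycle_mod j v /\ forall i : 'I_d, (j <= i)%N -> bound_mod j ('X_i ^+ t *: v).

(* The connecting homomorphism of 0 -> F/q_j -> F/q_j -> F/q_{j+1} -> 0, as a relation. *)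
Lemma kdim_tor_step (j : 'I_d) l :
  kdim (@bound_mod j j) (@tor_cycle j) l -> kdim (@bound_mod j.+1 j.+1) (@tor_cycle j.+1) l.
Proof.
pose x : R := 'X_j ^+ t.
pose G (w : 'rV[R]_(r j)) (v : 'rV[R]_(r j.+1)) := qm j (v *m D j - x *: w).
have sq n p := @power_mx_submod k d t n p j.
have sq' n p := @power_mx_submod k d t n p j.+1.
have GZ a w v : G w v -> G (a *: w) (a *: v).
  by rewrite /G -scalemxAl scalerA mulrC -scalerA -scalerBr; apply: (submodZ (sq _ _)).
have GD w v w' v' : G w v -> G w' v' -> G (w + w') (v + v').
  by rewrite /G mulmxDl scalerDr opprD addrACA; apply: (submodD (sq _ _)).
have GN w v : G w v -> (bound_mod j w <-> bound_mod j.+1 v).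
  move=> g; split=> [[y qy]|[u]].
    have [w' qw'] : @bound_mod j.+1 j (v - x *: y).
      apply: resolution_mod_exact => //; first exact: ltnW.
      rewrite /cycle_mod mulmxBl -(subrK (x *: w) (v *m _)) -addrA -scalemxAl -scalerBr.
      by apply: (submodD (sq _ _)) => //; apply: (submodZ (sq _ _)).
    exists w'; rewrite -(subrK (x *: y) v) addrAC; apply: (submodD (sq' _ _)).
      exact: power_mx_le qw'.
    exact: power_mx_exp.
  move/(@power_mx_split _ _ _ _ _ j) => [a [y [qa e]]]; exists y.
  apply: (@power_mx_regular _ _ _ _ _ j); rewrite scalerBr scalemxAl.
  have -> : x *: w - (x *: y) *m D j = a *m D j - (v *m D j - x *: w).
    have -> : v = a + x *: y + u *m D j.+1 by rewrite -e subrK.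
    by rewrite !mulmxDl resolution_complex addr0 opprB opprD addrCA addNKr.
  by apply: (submodB (sq _ _)) => //; apply: power_mx_mulr.
apply: (kdim_corr (G := G)).
- by rewrite /G mul0mx scaler0 subr0; case: (sq 1%N (r j)).
- by move=> a u u' v v' g g'; apply: GD => //; apply: GZ.
- move=> w [cw bw]; have [v qv] := bw j (leqnn j).
  have g : G w v by rewrite /G -opprB; apply: (submodN (sq _ _)).
  exists v; split=> //; split=> [|i ji].
    rewrite /cycle_mod -(subrK (x *: w) (v *m _)); apply: (submodD (sq' _ _)).
      exact: power_mx_le g.
    exact: power_mx_exp.
  by apply/(GN ('X_i ^+ t *: w)); [apply: GZ | apply: bw; apply: ltnW].
- move=> v [cv bv]; have [a [w [qa e]]] := @power_mx_split _ _ _ _ _ j _ cv.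
  have g : G w v by rewrite /G e addrK.
  exists w; split=> //; split=> [|i]; first exact: cycle_mod_quotient g.
  rewrite leq_eqVlt => /orP [/eqP/val_inj<-|ji]; last by apply/(GN _ ('X_i ^+ t *: v)); [apply: GZ | apply: bv].
  by exists v; rewrite -opprB; apply: (submodN (sq _ _)).
exact: GN.
Qed.

(** The augmentation identifies $F_0$ modulo boundaries with $R/J$, which settles [j = 0]; each
    further variable is one connecting homomorphism. *)
Lemma kdim_tor l : 
  kdim (V := R^o) J (fun f => forall i : 'I_d, J ('X_i ^+ t * f)) l ->
  kdim (@bound_mod d d) (@cycle_mod d d) l.
Proof.
move=> kd; case: res => -[v1 hv1] [ex0 _].
have sJ := ideal_submod iJ.
suff : forall j, (j <= d)%N -> kdim (@bound_mod j j) (@tor_cycle j) l.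
  move=> /(_ d (leqnn d)); apply: kdim_ext => // v; split=> [[]|cv] //.
  by split=> // i; rewrite leqNgt ltn_ord.
elim=> [_|j IH ltj]; last by apply: (kdim_tor_step (j := Ordinal ltj)); apply/IH/ltnW.
pose G (f : R^o) (v : 'rV[R]_(r 0%N)) := J ((v *m c) 0 0 - f).
have GN f v : G f v -> (J f <-> bound_mod 0 v).
  move=> g; split=> [Jf|[w /power_mx0 /eqP]].
    have /ex0 [w ->] : J ((v *m c) 0 0) by rewrite -(subrK f (_ 0 0)); apply: idealD.
    by exists w; rewrite subrr; case: (@power_mx_submod k d t 1 (r 0%N) 0).
  rewrite subr_eq0 => /eqP e; rewrite -[f](subKr ((v *m c) 0 0)); apply: idealB => //.
  by apply/ex0; exists w.
have GZ a f v : G f v -> G (a * f) (a *: v).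
  by rewrite /G => g; rewrite -scalemxAl mxE -mulrBr; apply: idealM.
apply: (kdim_corr (G := G) _ _ _ _ _ kd) => //.
- by rewrite /G mul0mx mxE subr0; apply: ideal0.
- move=> a u u' v v' g g'; rewrite /G mulmxDl mxE opprD addrACA; apply: idealD => //.
  exact: (GZ a%:MP).
- move=> f Pf; exists (f *: v1).
  have g : G f (f *: v1).
    rewrite /G -scalemxAl mxE -[X in _ - X]mulr1 -mulrBr; apply: idealM => //.
    by rewrite -opprB; apply: (submodN sJ).
  split=> //; split=> // i _; apply/(GN _ _ (GZ ('X_i ^+ t) _ _ g)); exact: Pf.
move=> v [_ bv]; exists ((v *m c) 0 0); have g : G ((v *m c) 0 0) v by rewrite /G subrr; apply: ideal0.
by split=> // i; apply/(GN _ _ (GZ ('X_i ^+ t) _ _ g)); apply: bv.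
Qed.

End Resolution.

(** * Duality over R/(x_1^t, ..., x_d^t) *)

(** [S] is the row space of a matrix of largest rank with rows in [S], and a vector outside is
    detected by a column of the cokernel of that matrix. *)
Lemma row_subspace_separation (k : fieldType) (N : nat) (S : 'rV[k]_N -> Prop) (y : 'rV[k]_N) :
  S 0 -> (forall (a : k) u v, S u -> S v -> S (a *: u + v)) -> ~ S y ->
  exists c : 'cV[k]_N, (forall s, S s -> s *m c = 0) /\ y *m c != 0.
Proof.
move=> S0 SS nSy.
have Ssum m (A : 'M[k]_(m, N)) (w : 'rV_m) : (forall i, S (row i A)) -> S (w *m A).
  move=> SA; rewrite mulmx_sum_row; apply: (big_ind S) => // [u v Su Sv|i _].
    by rewrite -[u]scale1r; apply: SS.
  by rewrite -[_ *: _]addr0; apply: SS.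
pose Q n := exists A : 'M[k]_N, (forall i, S (row i A)) /\ (N - \rank A = n)%N.
have [|n [[A [SA eA]] mn]] := @ex_min_prop Q (N - \rank (0 : 'M[k]_N)).
  by exists 0; split=> // i; rewrite row0.
have full s : S s -> (s <= A)%MS.
  move=> Ss; apply: NNPP => nle.
  pose A' := (A + s)%MS.
  have SA' i : S (row i A').
    have : (row i A' <= A + s)%MS by apply: row_sub.
    move=> /sub_addsmxP [[u v] /= ->].
    rewrite -[_ + _]/(u *m A + v *m s) -[u *m A]scale1r; apply: SS; first exact: Ssum.
    by apply: Ssum => j; rewrite [j]ord1 row_id.
  have QA' : Q (N - \rank A')%N by exists A'.
  apply: (mn _ _ QA').
  have lt : (\rank A < \rank A')%N.
    apply: rank_ltmx; rewrite ltmxE addsmxSl /=; apply/negP => le; apply: nle.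
    exact: submx_trans (addsmxSr _ _) le.
  by rewrite -eA; apply: ltn_sub2l => //; apply: leq_trans lt (rank_leq_col _).
have [j nz] : exists j, (y *m cokermx A) 0 j != 0.
  apply: NNPP => h; apply: nSy.
  have /submxP [w ->] : (y <= A)%MS; last exact: Ssum.
  rewrite submxE; apply/eqP/rowP => j; rewrite [RHS]mxE; apply/eqP.
  by apply: contraT => nz; case: h; exists j.
exists (col j (cokermx A)); split=> [s Ss|].
  have := full s Ss; rewrite submxE => /eqP e.
  by rewrite colE mulmxA e mul0mx.
apply: contra_neq nz; rewrite colE mulmxA -colE => /matrixP /(_ 0 0).
by rewrite mxE => ->; rewrite mxE.
Qed.

Section Residue.
Variables (k : fieldType) (d t : nat).
Hypothesis t0 : (0 < t)%N.
Local Notation R := {mpoly k[d]}.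
Local Notation qm := (@power_mx k d t _ _ d).

(** The $R$-bilinear product followed by the socle functional of $R/q_d$: it induces a perfect
    pairing over [k] on free modules over this ring. *)
Definition residue n (v : 'rV[R]_n) (u : 'cV[R]_n) : k := ((v *m u) 0 0)@_(top_mnm d t).

Section Pairing.
Variable n : nat.
Implicit Types (v w : 'rV[R]_n) (u : 'cV[R]_n).

Lemma residueDl v w u : residue (v + w) u = residue v u + residue w u.
Proof. by rewrite /residue mulmxDl mxE mcoeffD. Qed.

Lemma residueDr v u u' : residue v (u + u') = residue v u + residue v u'.
Proof. by rewrite /residue mulmxDr mxE mcoeffD. Qed.

Lemma residueZl (a : k) v u : residue (a%:MP *: v) u = a * residue v u.
Proof. by rewrite /residue -scalemxAl mxE mcoeffCM. Qed.

Lemma residueZr (a : k) v u : residue v (a%:MP *: u) = a * residue v u.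
Proof. by rewrite /residue -scalemxAr mxE mcoeffCM. Qed.

Lemma residue0l u : residue 0 u = 0.
Proof. by rewrite /residue mul0mx mxE mcoeff0. Qed.

Lemma residue0r v : residue v 0 = 0.
Proof. by rewrite /residue mulmx0 mxE mcoeff0. Qed.

Lemma residue_suml (I : Type) (s : seq I) (p : pred I) (F : I -> 'rV[R]_n) u :
  residue (\sum_(i <- s | p i) F i) u = \sum_(i <- s | p i) residue (F i) u.
Proof. by apply: (big_ind2 (fun x y => residue x u = y)) => [|x a y b <- <-|//]; rewrite ?residue0l ?residueDl. Qed.

Lemma residue_sumr (I : Type) (s : seq I) (p : pred I) v (F : I -> 'cV[R]_n) :
  residue v (\sum_(i <- s | p i) F i) = \sum_(i <- s | p i) residue v (F i).
Proof. exact: (big_morph (residue v) (residueDr v) (residue0r v)). Qed.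

Lemma residue_power_l v u : qm v -> residue v u = 0.
Proof.
move=> qv; rewrite /residue.
have /(power_ideal_residue _ t0) /(_ 1) := power_mx_mulr u qv 0 0; by rewrite mul1r.
Qed.

Lemma residue_power_r v u : qm u -> residue v u = 0.
Proof.
move=> qu; rewrite /residue.
have /(power_ideal_residue _ t0) /(_ 1) := power_mx_mull v qu 0 0; by rewrite mul1r.
Qed.

Lemma residue_tr v u : residue v u = residue u^T v^T.
Proof. by rewrite /residue -trmx_mul [_^T _ _]mxE. Qed.

Lemma residue_nondeg_l v : (forall u, residue v u = 0) -> qm v.
Proof.
move=> h a b; rewrite [a]ord1; apply/(power_ideal_residue _ t0) => g.
have := h (g *: delta_mx b 0); rewrite /residue -scalemxAr mxE.
by rewrite -colE mxE.
Qed.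

Lemma residue_nondeg_r u : (forall v, residue v u = 0) -> qm u.
Proof.
move=> h; have q : qm u^T by apply: residue_nondeg_l => v; rewrite residue_tr trmxK.
by move=> a b; have := q b a; rewrite mxE.
Qed.

(** Coefficients at monomials with exponents below [t] identify $(R/q_d)^n$ with a space of vectors
    over [k]. There a functional separates [v] from [S], and every functional is the residue against
    some [u]. *)
Lemma residue_separation_l (S : 'rV[R]_n -> Prop) v : subspace S ->
  (forall w, qm w -> S w) -> ~ S v ->
  exists u, (forall s, S s -> residue s u = 0) /\ residue v u != 0.
Proof.
move=> sS qS nSv.
pose T := ('I_n * {ffun 'I_d -> 'I_t})%type.
pose co (w : 'rV[R]_n) (x : T) : k := (w 0 x.1)@_(box_mnm x.2).
pose iota (w : 'rV[R]_n) : 'rV[k]_#|{: T}| := \row_i co w (enum_val i).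
have iotaP (a : k) w w' : iota (a%:MP *: w + w') = a *: iota w + iota w'.
  by apply/rowP => i; rewrite !mxE /co !mxE mcoeffD mcoeffCM.
have iota_inj w w' : iota w = iota w' -> qm (w - w').
  move=> e a b m hm; rewrite [a]ord1.
  have lt i : (m i < t)%N by apply: hm.
  have em : m = box_mnm [ffun i => Ordinal (lt i)].
    by apply/mnmP => i; rewrite mnmE ffunE.
  pose x : T := (b, [ffun i => Ordinal (lt i)]).
  have := congr1 (fun M : 'rV_#|{: T}| => M 0 (enum_rank x)) e.
  by rewrite !mxE enum_rankK /co /x /= -em mcoeffB => ->; rewrite subrr.
pose S' y := exists w, S w /\ iota w = y.
have [|a y y' [w [Sw <-]] [w' [Sw' <-]]||c [Sc nz]] := @row_subspace_separation k _ S' (iota v).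
- exists 0; split; first by case: sS.
  by apply/rowP => i; rewrite !mxE /co mxE mcoeff0.
- by exists (a%:MP *: w + w'); rewrite iotaP; split=> //; apply: sS.2.
- move=> [w [Sw e]]; apply: nSv; apply: (subspace_eqmod sS _ Sw); apply: qS.
  exact: iota_inj.
(* Pairing with the monomial complementary to [box_mnm x] reads off the coefficient at [box_mnm x],
   so this [u] realises the functional [c]. *)
pose u : 'cV[R]_n := \col_a \sum_(x : {ffun 'I_d -> 'I_t})
    (c (enum_rank (a, x)) 0) *: 'X_[top_mnm d t - box_mnm x].
have ru w : residue w u = (iota w *m c) 0 0.
  rewrite /residue !mxE raddf_sum /= (reindex (@enum_rank T)) /=; last first.
    by exists enum_val => i _; rewrite ?enum_rankK ?enum_valK.
  rewrite (eq_bigr (fun x => co w (x.1, x.2) * c (enum_rank (x.1, x.2)) 0)); last first.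
    by move=> [a x] _; rewrite mxE enum_rankK.
  rewrite -(pair_bigA _ (fun a x => co w (a, x) * c (enum_rank (a, x)) 0)) /=.
  apply: eq_bigr => a _; rewrite mxE mulr_sumr raddf_sum; apply: eq_bigr => x _ /=.
  rewrite -scalerAr mcoeffZ mulrC; congr (_ * _).
  have le : (box_mnm x <= top_mnm d t)%MM.
    by apply/mnm_lepP => i; rewrite !mnmE -ltnS prednK.
  by rewrite -{1}(submK le) mcoeffMX.
exists u; split=> [s Ss|].
  by rewrite ru Sc ?mxE //; exists s.
rewrite ru; apply: contra_neq nz => e; apply/matrixP => a b; by rewrite [a]ord1 [b]ord1 e mxE.
Qed.

End Pairing.

Lemma residue_separation_r n (S : 'cV[R]_n -> Prop) u : subspace S ->
  (forall w, qm w -> S w) -> ~ S u ->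
  exists v, (forall s, S s -> residue v s = 0) /\ residue v u != 0.
Proof.
move=> sS qS nSu.
have [|w qw||u' [hS nz]] := @residue_separation_l n (fun v => S v^T) u^T.
- split; first by rewrite trmx0; case: sS.
  by move=> a v w Sv Sw; rewrite linearP; apply: sS.2.
- by apply: qS => a b; rewrite mxE; apply: qw.
- by rewrite trmxK.
exists u'^T; split=> [s Ss|]; last by rewrite residue_tr trmxK.
by rewrite residue_tr trmxK; apply: hS; rewrite trmxK.
Qed.

Definition orth n (S : 'rV[R]_n -> Prop) (u : 'cV[R]_n) : Prop :=
  forall s, S s -> residue s u = 0.

(** A basis of $Z/B$ has a dual basis in the orthogonal of [B] modulo that of [Z]. *)
Lemma kdim_orth n (B Z : 'rV[R]_n -> Prop) l : subspace B -> (forall v, qm v -> B v) ->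
  kdim B Z l -> kdim (orth Z) (orth B) l.
Proof.
move=> sB qB [z [Zz [span iz]]].
have combD (a b : 'I_l -> k) (c : k) : comb (fun i => c * a i + b i) z = c%:MP *: comb a z + comb b z.
  rewrite /comb scaler_sumr -big_split; apply: eq_bigr => i _.
  by rewrite mpolyCD mpolyCM scalerDl scalerA.
have ex i : exists u, orth B u /\ forall j, residue (z j) u = (j == i)%:R.
  (* [S] is [B] plus the span of the [z j] with [j] different from [i]; what separates [z i] from it
     is the dual vector up to scale. *)
  pose S v := exists a : 'I_l -> k, a i = 0 /\ B (v - comb a z).
  have BS v : B v -> S v.
    move=> Bv; exists (fun _ => 0); split=> //; rewrite /comb big1 ?subr0 // => j _.
    by rewrite mpolyC0 scale0r.
  have sS : subspace S.
    split; first by apply: BS; case: sB.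
    move=> c v w [a [ai Ba]] [b [bi Bb]]; exists (fun j => c * a j + b j).
    split; first by rewrite ai bi mulr0 addr0.
    rewrite combD.
    have -> : c%:MP *: v + w - (c%:MP *: comb a z + comb b z) =
      c%:MP *: (v - comb a z) + (w - comb b z) by rewrite scalerBr opprD addrACA.
    exact: (sB.2 c _ _ Ba Bb).
  have zcomb j : z j = comb (fun j' => (j' == j)%:R) z.
    rewrite /comb (bigD1 j) //= eqxx mpolyC1 scale1r big1 ?addr0 // => j' /negPf->.
    by rewrite mpolyC0 scale0r.
  have nS : ~ S (z i).
    move=> [a [ai Ba]].
    have /iz /(_ i) /eqP : B (comb (fun j => (-1) * a j + (j == i)%:R) z).
      by rewrite combD -zcomb mpolyCN mpolyC1 scaleN1r addrC.
    by rewrite ai mulr0 add0r eqxx oner_eq0.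
  have [u [uS nz]] := residue_separation_l sS (fun w qw => BS w (qB w qw)) nS.
  exists ((residue (z i) u)^-1%:MP *: u); split=> [v /BS /uS e|j].
    by rewrite residueZr e mulr0.
  rewrite residueZr; case: (altP (j =P i)) => [->|ji]; first by rewrite mulVf.
  have Sj : S (z j).
    exists (fun j' => (j' == j)%:R); rewrite eq_sym (negPf ji); split=> //.
    by rewrite -zcomb subrr; case: sB.
  by rewrite (uS _ Sj) mulr0.
have [u hu] := fun_choice ex.
have rc a i : residue (z i) (comb a u) = a i.
  rewrite /comb residue_sumr (bigD1 i) //= residueZr (hu i).2 eqxx mulr1 big1 ?addr0 // => j ji.
  by rewrite residueZr (hu j).2 eq_sym (negPf ji) mulr0.
exists u; split; first by move=> i; case: (hu i).
split=> [u' Bu'|a Za i]; last by rewrite -(rc a i); apply: Za.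
(* After subtracting the combination with these coefficients, the rest is orthogonal to [B] and to
   every [z i], hence to [Z]. *)
exists (fun i => residue (z i) u') => v Zv.
have [b Bb] := span v Zv.
rewrite -(subrK (comb b z) v) residueDl; set u'' := u' - _.
have Bu'' : orth B u''.
  move=> w Bw; rewrite /u'' residueDr Bu' // add0r -scaleN1r -mpolyC1 -mpolyCN residueZr.
  rewrite /comb residue_sumr big1 ?mulr0 // => i _.
  by rewrite residueZr (hu i).1 ?mulr0.
rewrite Bu'' // add0r /comb residue_suml big1 // => i _.
rewrite residueZl /u'' residueDr -scaleN1r -mpolyC1 -mpolyCN residueZr rc mulN1r subrr mulr0 //.
Qed.

End Residue.

(** * Cohomology of the dual complex modulo the ideals $q_j$ *)

Section DualComplex.
Variables (k : fieldType) (d t : nat).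
Hypothesis t0 : (0 < t)%N.
Local Notation R := {mpoly k[d]}.
Variables (J : R -> Prop) (r : nat -> nat) (D : forall i, 'M[R]_(r i.+1, r i)).
Variable (c : 'cV[R]_(r 0%N)).
Hypothesis iJ : is_ideal J.
Hypothesis res : free_resolution J D c.
Local Notation qm := (@power_mx k d t _ _).

(* Cocycles of degree i, and coboundaries of degree i + 1, of Hom(F, R/q_j). *)
Definition cocycle_mod i j (u : 'cV[R]_(r i)) : Prop := qm j (D i *m u).
Definition cobound_mod i j (u : 'cV[R]_(r i.+1)) : Prop :=
  exists w : 'cV[R]_(r i), qm j (u - D i *m w).

Lemma cocycle_mod_submod i j : is_submod (@cocycle_mod i j).
Proof.
have [q0 qS] := @power_mx_submod k d t (r i.+1) 1 j.
split; first by rewrite /cocycle_mod mulmx0.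
by move=> a u v qu qv; rewrite /cocycle_mod mulmxDr -scalemxAr; exact: (qS a _ _ qu qv).
Qed.

Lemma cobound_mod_submod i j : is_submod (@cobound_mod i j).
Proof.
have [q0 qS] := @power_mx_submod k d t (r i.+1) 1 j.
split=> [|a u v [w qw] [w' qw']]; first by exists 0; rewrite mulmx0 subr0.
exists (a *: w + w').
have -> : a *: u + v - D i *m (a *: w + w') = a *: (u - D i *m w) + (v - D i *m w').
  by rewrite mulmxDr scalerBr -scalemxAr opprD addrACA.
exact: (qS a _ _ qw qw').
Qed.

Lemma cobound_mod_power i j u : qm j u -> @cobound_mod i j u.
Proof. by move=> qu; exists 0; rewrite mulmx0 subr0. Qed.

Lemma cobound_mod_le i j j' u : (j <= j')%N -> @cobound_mod i j u -> @cobound_mod i j' u.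
Proof. by move=> le [w qw]; exists w; apply: power_mx_le qw. Qed.

Lemma cocycle_mod_le i j j' u : (j <= j')%N -> @cocycle_mod i j u -> @cocycle_mod i j' u.
Proof. by move=> le; apply: power_mx_le. Qed.

(** Left and right multiplication by [D i] are adjoint for the residue pairing, which is
    nondegenerate modulo $q_d$. *)
Lemma orth_bound_mod i u : orth t (bound_mod t D d) u <-> @cocycle_mod i d u.
Proof.
split=> [o|q s [w qw]].
  apply: (residue_nondeg_r t0) => v; have := o (v *m D i); rewrite /residue mulmxA; apply.
  by exists v; rewrite subrr; case: (@power_mx_submod k d t 1 (r i) d).
rewrite -(subrK (w *m D i) s) residueDl (residue_power_l t0 _ qw) add0r.
by have := residue_power_r t0 w q; rewrite /residue mulmxA.
Qed.

(** The forward direction needs separation: a [u] that is no coboundary is detected by some [v]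
    orthogonal to all coboundaries, and adjointness makes [v] a cycle. *)
Lemma orth_cycle_mod i u : orth t (@cycle_mod k d t r D i.+1 d) u <-> @cobound_mod i d u.
Proof.
split=> [o|[w qw] s cs].
  apply: NNPP => nb.
  have [v [vS nz]] := residue_separation_r t0 (submod_subspace (cobound_mod_submod i d))
                        (fun w qw => cobound_mod_power qw) nb.
  case/eqP: nz; apply: o; apply: (residue_nondeg_l t0) => w.
  have := vS (D i *m w); rewrite /residue mulmxA; apply.
  by exists w; rewrite subrr; case: (@power_mx_submod k d t (r i.+1) 1 d).
rewrite -(subrK (D i *m w) u) residueDr (residue_power_r t0 _ qw) add0r.
by have := residue_power_l t0 w cs; rewrite /residue mulmxA.
Qed.

(** Taking orthogonals exchanges cycles with coboundaries and boundaries with cocycles, so this is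
    dual to the homology found in [kdim_tor]. *)
Lemma kdim_cohomology_mod l (e : nat) : d = e.+1 ->
  kdim (V := R^o) J (fun f => forall i : 'I_d, J ('X_i ^+ t * f)) l ->
  kdim (@cobound_mod e d) (@cocycle_mod e.+1 d) l.
Proof.
move=> de /(kdim_tor iJ res) kd.
have kd' : kdim (@bound_mod k d t r D e.+1 d) (@cycle_mod k d t r D e.+1 d) l.
  suff : forall i, i = d -> kdim (@bound_mod k d t r D i d) (@cycle_mod k d t r D i d) l by apply.
  by move=> i ->.
have := kdim_orth t0 (submod_subspace (@bound_mod_submod k d t r D e.+1 d))
  (fun v qv => bound_mod_power D qv) kd'.
by apply: kdim_ext => v; [apply: orth_cycle_mod | apply: orth_bound_mod].
Qed.

(** Dual to the vanishing of $H_{i+1}(F/q_d F)$ for $i + 1 > d$. *)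
Lemma cohomology_mod_vanish i u : (d <= i)%N -> @cocycle_mod i.+1 d u -> @cobound_mod i d u.
Proof.
move=> di /orth_bound_mod o; apply/orth_cycle_mod => s cs; apply: o.
by apply: (resolution_mod_exact res).
Qed.

End DualComplex.

(** * Annihilators of Ext modules are homogeneous *)

Section Scaling.
Variables (k : fieldType) (d : nat).
Local Notation R := {mpoly k[d]}.

Definition scale_var (a : k) (f : R) : R := mmap (@mpolyC d k) (fun i => a *: 'X_i) f.

HB.instance Definition _ a := GRing.RMorphism.copy (scale_var a) (mmap (@mpolyC d k) (fun i => a *: 'X_i)).

Lemma mcoeff_scale_var a f m : (scale_var a f)@_m = a ^+ mdeg m * f@_m.
Proof.
elim/mpolyind: f => [|c m' p _ _ IH]; first by rewrite raddf0 !mcoeff0 mulr0.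
rewrite raddfD /= !mcoeffD IH mulrDr; congr (_ + _).
have -> : scale_var a (c *: 'X_[m']) = (c * a ^+ mdeg m') *: 'X_[m'].
  rewrite /scale_var mmapZ mmapX /mmap1; under eq_bigr do rewrite exprZn.
  by rewrite scaler_prod -mpolyXE_id prodrXr -mdegE mul_mpolyC scalerA.
rewrite !mcoeffZ mcoeffX; case: eqP => [->|]; last by rewrite !mulr0.
by rewrite !mulr1 mulrC.
Qed.

Lemma scale_varK a : a != 0 -> cancel (scale_var a) (scale_var a^-1).
Proof.
move=> a0 f; apply/mpolyP => m.
by rewrite !mcoeff_scale_var mulrA -exprMn mulVf // expr1n mul1r.
Qed.

Lemma scale_varVK a : a != 0 -> cancel (scale_var a^-1) (scale_var a).
Proof.
move=> a0 f; apply/mpolyP => m.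
by rewrite !mcoeff_scale_var mulrA -exprMn mulfV // expr1n mul1r.
Qed.

Lemma homog_scale_var (J : R -> Prop) a f : is_homog_ideal J -> J f -> J (scale_var a f).
Proof.
move=> [iJ hJ] Jf; rewrite (sum_hcomp f) raddf_sum; apply: ideal_sum => // t _ /=.
have -> : scale_var a (hcomp t f) = a ^+ t *: hcomp t f.
  apply/mpolyP => m; rewrite mcoeff_scale_var mcoeffZ !mcoeff_hcomp.
  by case: eqP => [->|]; rewrite ?mulr0.
by apply: idealZ => //; apply: hJ.
Qed.

(** Scaling by [a] multiplies the component of degree [t] by $a^t$. The scalars $1, \dots, N$ are
    distinct and nonzero in characteristic zero, and inverting their Vandermonde matrix recovers
    each component from scaled copies of [f]. *)
Lemma scale_var_homog (A : R -> Prop) : [pchar k] =i pred0 -> is_ideal A ->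
  (forall a f, a != 0 -> A f -> A (scale_var a f)) -> forall f t, A f -> A (hcomp t f).
Proof.
move=> char0 iA hA f t Af.
have nat_inj n : (n%:R == 0 :> k) = (n == 0%N) by have /pcharf0P := char0; apply.
pose N := maxn (msize f) t.+1.
have ltt : (t < N)%N by rewrite leq_maxr.
pose lam : 'rV[k]_N := \row_j (j.+1)%:R.
pose V := Vandermonde N lam.
have uV : V \in unitmx.
  rewrite unitmxE unitfE det_Vandermonde; apply/prodf_neq0 => i _; apply/prodf_neq0 => j ij.
  by rewrite !mxE -natrB ?ltnS ?(ltnW ij) // nat_inj subSS subn_eq0 -ltnNge.
suff -> : hcomp t f = \sum_(j < N) invmx V j (Ordinal ltt) *: scale_var (lam 0 j) f.
  apply: ideal_sum => // j _; apply: idealZ => //; apply: hA => //.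
  by rewrite mxE nat_inj.
apply/mpolyP => m; rewrite mcoeff_hcomp raddf_sum /=.
case: (ltnP (mdeg m) N) => [ltm|]; last first.
  rewrite geq_max => /andP [lem ltm].
  rewrite (memN_msupp_eq0 (msize_mdeg_ge lem)) if_same big1 // => j _.
  by rewrite mcoeffZ mcoeff_scale_var (memN_msupp_eq0 (msize_mdeg_ge lem)) !mulr0.
have /matrixP /(_ (Ordinal ltm) (Ordinal ltt)) := mulmxV uV; rewrite !mxE -val_eqE /= => e.
rewrite (eq_bigr (fun j => V (Ordinal ltm) j * invmx V j (Ordinal ltt) * f@_m)) => [|j _].
  by rewrite -mulr_suml e; case: (_ == _); rewrite ?mul1r ?mul0r.
by rewrite mcoeffZ mcoeff_scale_var [V _ _]mxE /= mulrCA mulrA.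
Qed.

End Scaling.

Lemma dependent_choice (T : nat -> Type) (Inv : forall i, T i -> Prop)
    (P : forall i, T i -> T i.+1 -> Prop) (x0 : T 0%N) :
  Inv 0%N x0 -> (forall i x, Inv i x -> exists y, Inv i.+1 y /\ P i x y) ->
  exists f : forall i, T i, f 0%N = x0 /\ forall i, Inv i (f i) /\ P i (f i) (f i.+1).
Proof.
move=> h0 hS.
have step i (s : {x | Inv i x}) : {y : {y | Inv i.+1 y} | P i (sval s) (sval y)}.
  apply: constructive_indefinite_description; have [y [Iy Py]] := hS i _ (svalP s).
  by exists (exist _ y Iy).
pose f := nat_rect (fun i => {x | Inv i x}) (exist _ x0 h0) (fun i s => sval (step i s)).
exists (fun i => sval (f i)); split=> // i; split; [apply: svalP | exact: (svalP (step i (f i)))].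
Qed.

(** * Comparison of free resolutions *)

Section Lifting.
Variables (k : fieldType) (d : nat).
Local Notation R := {mpoly k[d]}.
Variables (J : R -> Prop) (r : nat -> nat) (D : forall i, 'M[R]_(r i.+1, r i)).
Variable (c : 'cV[R]_(r 0%N)).
Hypothesis res : free_resolution J D c.

Lemma lift_rows n p q (X : 'M[R]_(n, q)) (B : 'M[R]_(p, q)) :
  (forall i, exists w, row i X = w *m B) -> exists W, X = W *m B.
Proof.
move=> h; have [w hw] := fun_choice h; exists (\matrix_i w i).
by apply/row_matrixP => i; rewrite row_mul rowK.
Qed.

Lemma resolution_lift0 n (X : 'M[R]_(n, r 0%N)) :
  (forall v : 'rV_n, J ((v *m X *m c) 0 0)) -> exists W, X = W *m D 0%N.
Proof.
move=> h; apply: lift_rows => i; case: res => _ [ex _]; apply/ex.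
by rewrite rowE; apply: h.
Qed.

Lemma resolution_lift n i (X : 'M[R]_(n, r i.+1)) :
  X *m D i = 0 -> exists W, X = W *m D i.+1.
Proof.
move=> h; apply: lift_rows => a; case: res => _ [_ ex]; apply/ex.
by rewrite -row_mul h row0.
Qed.

(** A chain endomorphism that induces zero on $R/J$ is null-homotopic: what each homotopy has to
    correct consists of cycles, which lift by exactness. *)
Lemma null_homotopy (phi : forall i, 'M[R]_(r i)) :
  (forall i, D i *m phi i = phi i.+1 *m D i) ->
  (forall v : 'rV_(r 0%N), J ((v *m phi 0%N *m c) 0 0)) ->
  exists h : forall i, 'M[R]_(r i, r i.+1),
    forall i, phi i.+1 = D i *m h i + h i.+1 *m D i.+1.
Proof.
move=> hphi h0; have [W0 e0] := resolution_lift0 h0.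
have [W1 e1] : exists W1, phi 1%N - D 0%N *m W0 = W1 *m D 1%N.
  by apply: resolution_lift; rewrite mulmxBl -hphi e0 mulmxA subrr.
(* A state holds two consecutive homotopies, so that the equation in degree [i.+1] is an invariant
   of a single state. *)
pose T i := ('M[R]_(r i, r i.+1) * 'M[R]_(r i.+1, r i.+2))%type.
pose Inv i (x : T i) := phi i.+1 = D i *m x.1 + x.2 *m D i.+1.
have [|i [x y] /= Ix|f [_ hf]] := @dependent_choice T Inv (fun i x y => y.1 = x.2) (W0, W1).
- by rewrite /Inv /= -e1 addrC subrK.
- have [W eW] : exists W, phi i.+2 - D i.+1 *m y = W *m D i.+2.
    apply: resolution_lift; rewrite mulmxBl -hphi Ix mulmxDr !mulmxA addrK.
    by rewrite -[D i.+1]mul1mx (resolution_complex res) mul0mx.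
  by exists (y, W); split=> //; rewrite /Inv /= -eW addrC subrK.
exists (fun i => (f i).1) => i; have [-> e] := hf i; by rewrite -e.
Qed.

End Lifting.

Section Comparison.
Variables (k : fieldType) (d : nat).
Local Notation R := {mpoly k[d]}.
Variables (J : R -> Prop).
Hypothesis iJ : is_ideal J.
Variables (r : nat -> nat) (D : forall i, 'M[R]_(r i.+1, r i)) (c : 'cV[R]_(r 0%N)).
Variables (r' : nat -> nat) (D' : forall i, 'M[R]_(r' i.+1, r' i)) (c' : 'cV[R]_(r' 0%N)).
Hypothesis res : free_resolution J D c.
Hypothesis res' : free_resolution J D' c'.

(** [alpha 0] sends [v] to $\varepsilon(v) v'$, where $\varepsilon'(v') = 1$ modulo [J]; the higher
    maps are lifted row by row through the exact resolution [D']. *)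
Lemma chain_map_exists : exists alpha : forall i, 'M[R]_(r i, r' i),
  (forall i, D i *m alpha i = alpha i.+1 *m D' i) /\
  (forall v : 'rV_(r 0%N), J ((v *m c) 0 0 - (v *m alpha 0%N *m c') 0 0)).
Proof.
have [[v' Jv'] _] := res'; have [_ [ex _]] := res.
have m11 (A B : 'M[R]_1) : (A *m B) 0 0 = A 0 0 * B 0 0 by rewrite mxE big_ord1.
have [W0 e0] : exists W, D 0%N *m (c *m v') = W *m D' 0%N.
  apply: (resolution_lift0 res') => v; rewrite !mulmxA -(mulmxA _ v') m11 mulrC.
  by apply: idealM => //; apply/ex; exists v.
pose T i := ('M[R]_(r i, r' i) * 'M[R]_(r i.+1, r' i.+1))%type.
pose Inv i (x : T i) := D i *m x.1 = x.2 *m D' i.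
have [|i [x y] /= Ix|f [f0 hf]] := @dependent_choice T Inv (fun i x y => y.1 = x.2) (c *m v', W0).
- exact: e0.
- have [W eW] : exists W, D i.+1 *m y = W *m D' i.+1.
    apply: (resolution_lift res'); rewrite -mulmxA -Ix mulmxA.
    by rewrite -[D i.+1]mul1mx (resolution_complex res) mul0mx.
  by exists (y, W).
exists (fun i => (f i).1); split=> [i|v]; first by have [-> ->] := hf i.
rewrite f0 /= !mulmxA -(mulmxA _ v') m11 -[X in X - _]mulr1 -mulrBr.
exact: idealM.
Qed.

End Comparison.

Section Annihilator.
Variables (k : fieldType) (d t : nat).
Local Notation R := {mpoly k[d]}.
Variables (J : R -> Prop).
Hypothesis hJ : is_homog_ideal J.
Variables (r : nat -> nat) (D : forall i, 'M[R]_(r i.+1, r i)) (c : 'cV[R]_(r 0%N)).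
Hypothesis res : free_resolution J D c.
Local Notation qm := (@power_mx k d t _ _).
Let iJ := hJ.1.

(* Elements killing Ext^{i+1}(R/J, R/q_j). *)
Definition ext_annihilator i j (a : R) : Prop :=
  forall u, cocycle_mod t D j u -> @cobound_mod k d t r D i j (a *: u).

Lemma ext_annihilator_ideal i j : is_ideal (ext_annihilator i j).
Proof.
have sB := @cobound_mod_submod k d t r D i j.
split; first by move=> u _; rewrite scale0r; case: sB.
split=> [a b ha hb u cu|b a ha u cu].
  by rewrite scalerDl; apply: (submodD sB); [apply: ha | apply: hb].
by rewrite -scalerA; apply: (submodZ sB); apply: ha.
Qed.

Lemma power_mx_scale_var (a : k) j n p (A : 'M[R]_(n, p)) :
  qm j A -> qm j (map_mx (scale_var a) A).
Proof. by move=> qA x y m hm; rewrite mxE mcoeff_scale_var qA // mulr0. Qed.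

Lemma free_resolution_scale (a : k) : a != 0 ->
  free_resolution J (fun i => map_mx (scale_var a) (D i)) (map_mx (scale_var a) c).
Proof.
move=> a0.
have a'0 : a^-1 != 0 by rewrite invr_eq0.
have Kmx n p (A : 'M[R]_(n, p)) : map_mx (scale_var a) (map_mx (scale_var a^-1) A) = A.
  by apply/matrixP => x y; rewrite !mxE scale_varVK.
have K'mx n p (A : 'M[R]_(n, p)) : map_mx (scale_var a^-1) (map_mx (scale_var a) A) = A.
  by apply/matrixP => x y; rewrite !mxE scale_varK.
have Js f : J ((scale_var a) f) <-> J f.
  split=> h; last exact: homog_scale_var.
  by rewrite -(scale_varK a0 f); apply: homog_scale_var.
have ent (v : 'rV[R]_(r 0%N)) : (v *m map_mx (scale_var a) c) 0 0 = (scale_var a) ((map_mx (scale_var a^-1) v *m c) 0 0).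
  by rewrite -[v in LHS]Kmx -map_mxM mxE.
case: res => -[v1 Jv1] [ex0 ex]; split.
  by exists (map_mx (scale_var a) v1); rewrite ent K'mx -(rmorph1 (scale_var a)) -rmorphB; apply/Js.
split=> [v|i v].
  rewrite ent; split=> [/Js /ex0 [w e]|[w e]].
    by exists (map_mx (scale_var a) w); rewrite -map_mxM -e Kmx.
  by apply/Js/ex0; exists (map_mx (scale_var a^-1) w); rewrite e map_mxM K'mx.
split=> [e|[w e]].
  have /ex [w ew] : map_mx (scale_var a^-1) v *m D i = 0.
    by rewrite -[D i]K'mx -map_mxM e map_mx0.
  by exists (map_mx (scale_var a) w); rewrite -map_mxM -ew Kmx.
have /(congr1 (map_mx (scale_var a))) : map_mx (scale_var a^-1) v *m D i = 0.
  by apply/ex; exists (map_mx (scale_var a^-1) w); rewrite e map_mxM K'mx.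
by rewrite map_mxM Kmx map_mx0.
Qed.

(** A cocycle goes to the scaled resolution by [be], then to the original one by the inverse
    scaling, where [a] makes it a coboundary. Scaling this back and applying [al] gives the claim up
    to the homotopy from [al i *m be i] to the identity. *)
Lemma ext_annihilator_scale i j (x : k) a : x != 0 ->
  ext_annihilator i j a -> ext_annihilator i j (scale_var x a).
Proof.
move=> x0 ha u cu.
have K'mx n p (A : 'M[R]_(n, p)) : map_mx (scale_var x^-1) (map_mx (scale_var x) A) = A.
  by apply/matrixP => y z; rewrite !mxE scale_varK.
have Kmx n p (A : 'M[R]_(n, p)) : map_mx (scale_var x) (map_mx (scale_var x^-1) A) = A.
  by apply/matrixP => y z; rewrite !mxE scale_varVK.
have res' := free_resolution_scale x0.
have [al [hal al0]] := chain_map_exists iJ res res'.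
have [be [hbe be0]] := chain_map_exists iJ res' res.
pose phi i := al i *m be i - 1%:M.
have [|v|h hh] := @null_homotopy _ _ _ _ _ _ res phi.
- by move=> i'; rewrite /phi mulmxBr mulmxBl mulmx1 mul1mx !mulmxA hal -!mulmxA hbe.
- rewrite /phi mulmxBr mulmx1 mulmxBl !mxE -[X in J X]opprK; apply: (submodN (ideal_submod iJ)).
  have := idealD iJ (al0 v) (be0 (v *m al 0%N)); rewrite addrA subrK !mulmxA !mxE opprB; exact.
have /ha [w qw] : cocycle_mod t D j (map_mx (scale_var x^-1) (be i.+1 *m u)).
  rewrite /cocycle_mod -[D i.+1]K'mx -map_mxM; apply: power_mx_scale_var.
  by rewrite mulmxA hbe -mulmxA; apply: power_mx_mull.
have q1 : qm j ((scale_var x) a *: (be i.+1 *m u) - map_mx (scale_var x) (D i) *m map_mx (scale_var x) w).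
  have := power_mx_scale_var x qw; rewrite map_mxB map_mxZ Kmx map_mxM; exact.
have sq := @power_mx_submod k d t (r i.+1) 1 j.
(* The homotopy term absorbs the difference between the round trip and the identity, up to a term
   through [D i.+1 *m u], which lies in $q_j$. *)
exists (al i *m map_mx (scale_var x) w - h i *m ((scale_var x) a *: u)).
have -> : (scale_var x) a *: u - D i *m (al i *m map_mx (scale_var x) w - h i *m ((scale_var x) a *: u)) =
   al i.+1 *m ((scale_var x) a *: (be i.+1 *m u) - map_mx (scale_var x) (D i) *m map_mx (scale_var x) w)
   - h i.+1 *m ((scale_var x) a *: (D i.+1 *m u)).
  have e : (scale_var x) a *: u = al i.+1 *m ((scale_var x) a *: (be i.+1 *m u)) - D i *m (h i *m ((scale_var x) a *: u))
      - h i.+1 *m ((scale_var x) a *: (D i.+1 *m u)).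
    have aux (p q o : 'M[R]_(r i.+1)) : p + q + o - p - q = o.
      by rewrite -addrA -opprD [p + q + o]addrC addrK.
    rewrite -!scalemxAr -!scalerBr; congr (_ *: _); rewrite !mulmxA -!mulmxBl.
    have := hh i; rewrite /phi => /(canRL (subrK _)) ->.
    by rewrite aux mul1mx.
  have aux (p q o w' : 'cV[R]_(r i.+1)) : p - q - o - (w' - q) = p - w' - o.
    by rewrite opprB [p - q - o]addrAC addrA subrK addrAC.
  move: e; set X := _ *: u; set Y := _ *: (be i.+1 *m u); set Z := _ *: _; set w' := map_mx _ w.
  move=> e; rewrite {1}e.
  rewrite 2!mulmxBr [D i *m (al i *m w')]mulmxA hal -[_ *m _ *m w']mulmxA.
  exact: aux.
apply: (submodB sq); first exact: power_mx_mull.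
by apply: power_mx_mull; apply: (submodZ (@power_mx_submod k d t _ _ j)).
Qed.

Lemma ext_annihilator_homog i j a n : [pchar k] =i pred0 ->
  ext_annihilator i j a -> ext_annihilator i j (hcomp n a).
Proof.
move=> char0; apply: (scale_var_homog char0 (ext_annihilator_ideal i j)).
by move=> x f; apply: ext_annihilator_scale.
Qed.

End Annihilator.

Section Nakayama.
Variables (k : fieldType) (d n : nat).
Local Notation R := {mpoly k[d]}.

(* Z = B + mZ; a is the determinant of 1 - A, where A expresses generators of Z through mZ modulo B. *)
Lemma nakayama_cV (Z B : 'cV[R]_n -> Prop) : is_submod Z -> is_submod B ->
  (forall z, Z z -> exists y : 'I_d -> 'cV[R]_n, (forall i, Z (y i)) /\ B (z - \sum_i 'X_i *: y i)) ->
  exists a : R, a@_0%MM = 1 /\ forall z, Z z -> B (a *: z).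
Proof.
move=> sZ sB h; have [p [g [Zg hg]]] := noetherian_cV sZ.
have ex (x : 'I_p) : exists a : 'I_p -> R, (forall l, (a l)@_0%MM = 0) /\ B (g x - \sum_l a l *: g l).
  have [y [Zy By]] := h _ (Zg x).
  have [b hb] := fun_choice (fun i => hg _ (Zy i)).
  exists (fun l => \sum_i 'X_i * b i l); split=> [l|].
    rewrite raddf_sum /= big1 // => i _; rewrite rmorphM /= mcoeffX.
    by rewrite mnm1_eq0 mul0r.
  suff -> : \sum_l (\sum_i 'X_i * b i l) *: g l = \sum_i 'X_i *: y i by [].
  under eq_bigr do rewrite scaler_suml.
  rewrite exchange_big; apply: eq_bigr => i _ /=.
  by rewrite hb scaler_sumr; apply: eq_bigr => l _; rewrite scalerA.
have [A hA] := fun_choice ex.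
pose M : 'M[R]_p := 1%:M - \matrix_(x, l) A x l.
have BM x : B (\sum_l M x l *: g l).
  suff -> : \sum_l M x l *: g l = g x - \sum_l A x l *: g l by case: (hA x).
  rewrite /M; under eq_bigr do rewrite !mxE scalerBl; rewrite sumrB; congr (_ - _).
  rewrite (bigD1 x) //= eqxx scale1r big1 ?addr0 // => l; rewrite eq_sym => /negPf->.
  by rewrite scale0r.
exists (\det M); split=> [|z /hg [b ->]].
  rewrite -[LHS]/(mcoeff 0%MM (\det M)) -det_map_mx (_ : map_mx _ M = 1%:M) ?det1 //.
  apply/matrixP => x l; rewrite !mxE rmorphB /= (hA x).1 subr0.
  by case: (x == l); rewrite ?mcoeff1 ?eqxx ?mcoeff0.
rewrite scaler_sumr; apply: (submod_sum sB) => l _; rewrite scalerA mulrC -scalerA.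
apply: (submodZ sB).
suff -> : \det M *: g l = \sum_x \adj M l x *: \sum_l' M x l' *: g l'.
  by apply: (submod_sum sB) => x _; apply: (submodZ sB).
under eq_bigr do rewrite scaler_sumr; rewrite exchange_big /=.
rewrite (eq_bigr (fun l' => (\det M)%:M l l' *: g l')) => [|l' _]; last first.
  under eq_bigr do rewrite scalerA; rewrite -scaler_suml; congr (_ *: _).
  by rewrite -mul_adj_mx mxE.
rewrite (bigD1 l) //= mxE eqxx mulr1n big1 ?addr0 // => l' ne.
by rewrite mxE eq_sym (negPf ne) mulr0n scale0r.
Qed.

End Nakayama.

(** * The length of the top Ext module *)

Section ExtVanishing.
Variables (k : fieldType) (d t : nat).
Hypothesis char0 : [pchar k] =i pred0.
Hypothesis t0 : (0 < t)%N.
Local Notation R := {mpoly k[d]}.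
Variables (J : R -> Prop).
Hypothesis hJ : is_homog_ideal J.
Variables (r : nat -> nat) (D : forall i, 'M[R]_(r i.+1, r i)) (c : 'cV[R]_(r 0%N)).
Hypothesis res : free_resolution J D c.
Local Notation qm := (@power_mx k d t _ _).
Local Notation cocycle i := (@cocycle_mod k d t r D i).
Local Notation cobound i := (@cobound_mod k d t r D i).

Lemma dual_complex i (w : 'cV[R]_(r i)) : D i.+1 *m (D i *m w) = 0.
Proof. by rewrite mulmxA -[D i.+1]mul1mx (resolution_complex res) mul0mx. Qed.

Lemma hcomp0_unit (a : R) : a@_0%MM = 1 -> hcomp 0 a = 1.
Proof.
move=> a1; apply/mpolyP => m; rewrite mcoeff_hcomp mdeg_eq0 mcoeff1.
by case: eqP => [->|].
Qed.

Lemma cocycle_quotient (j : 'I_d) i (u y : 'cV[R]_(r i.+1)) (v : 'cV[R]_(r i)) :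
  cocycle i.+1 j u -> qm j (u - D i *m v - 'X_j ^+ t *: y) -> cocycle i.+1 j y.
Proof.
move=> cu q; have sq := @power_mx_submod k d t (r i.+2) 1 j.
apply: (@power_mx_regular _ _ _ _ _ j).
have -> : 'X_j ^+ t *: (D i.+1 *m y) = D i.+1 *m u - D i.+1 *m (u - D i *m v - 'X_j ^+ t *: y).
  by rewrite !mulmxBr dual_complex subr0 opprB addrC subrK scalemxAr.
by apply: (submodB sq) => //; apply: power_mx_mull.
Qed.

(** If the cohomology modulo $q_{j+1}$ vanishes, multiplication by $x_j^t$ is surjective on that
    modulo $q_j$. Nakayama's lemma yields an annihilator with constant term 1; its component of
    degree 0 also annihilates, and equals 1. *)
Lemma ext_vanish_step (j : 'I_d) i :
  (forall u, cocycle i.+1 j.+1 u -> cobound i j.+1 u) ->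
  forall u, cocycle i.+1 j u -> cobound i j u.
Proof.
move=> IH.
have sZ := @cocycle_mod_submod k d t r D i.+1 j.
have sB := @cobound_mod_submod k d t r D i j.
have [z cz|a [a1 ha]] := @nakayama_cV k d _ _ _ sZ sB.
  have [v] := IH z (cocycle_mod_le (leqnSn _) cz).
  move/(@power_mx_split _ _ _ _ _ j) => [b [y [qb e]]].
  have cy : cocycle i.+1 j y.
    by apply: (cocycle_quotient (v := v) cz); rewrite e addrK.
  exists (fun l => if l == j then 'X_j ^+ t.-1 *: y else 0); split=> [l|].
    by case: eqP => _; [apply: (submodZ sZ) | case: sZ].
  rewrite (bigD1 j) //= eqxx big1 => [|l /negPf->]; last by rewrite scaler0.
  rewrite addr0 scalerA -exprS prednK //; exists v.
  have -> : z - 'X_j ^+ t *: y - D i *m v = b by rewrite addrAC e addrK.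
  exact: qb.
have annA : ext_annihilator t D i j a by move=> u cu; apply: ha.
have := ext_annihilator_homog hJ res 0 char0 annA.
by rewrite hcomp0_unit // => h u /h; rewrite scale1r.
Qed.

(** Induction on [d - j], starting at [j = d], where duality gives the vanishing. *)
Lemma ext_vanish i j u : (d <= i)%N -> (j <= d)%N -> cocycle i.+1 j u -> cobound i j u.
Proof.
move=> di jd; rewrite -(subKn jd); move: (d - j)%N (leq_subr j d) u.
elim=> [_ u|n IH ltn]; first by rewrite subn0; apply: (cohomology_mod_vanish t0 res).
have lt : (d - n.+1 < d)%N by rewrite ltn_subrL (leq_ltn_trans _ ltn).
apply: (ext_vanish_step (j := Ordinal lt)) => /=.
by rewrite subnSK //; apply: IH; apply: ltnW.
Qed.

Section TopDegree.
Variable e : nat.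
Hypothesis de : d = e.+1.

Definition dual_kernel (u : 'cV[R]_(r e.+1)) : Prop := D e.+1 *m u = 0.
Definition dual_image (u : 'cV[R]_(r e.+1)) : Prop := exists w, u = D e *m w.

Lemma cocycle_mod0 u : cocycle e.+1 0 u <-> dual_kernel u.
Proof.
split=> [/power_mx0 //|]; rewrite /cocycle_mod /dual_kernel => ->.
by case: (@power_mx_submod k d t (r e.+2) 1 0).
Qed.

Lemma cobound_mod0 u : cobound e 0 u <-> dual_image u.
Proof.
split=> [[w /power_mx0 /eqP]|[w ->]]; first by rewrite subr_eq0 => /eqP->; exists w.
by exists w; rewrite subrr; case: (@power_mx_submod k d t (r e.+1) 1 0).
Qed.

Lemma dual_kernel_submod : is_submod dual_kernel.
Proof.
split; first by rewrite /dual_kernel mulmx0.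
by move=> a u v ku kv; rewrite /dual_kernel mulmxDr -scalemxAr ku kv scaler0 addr0.
Qed.

Lemma dual_image_submod : is_submod dual_image.
Proof.
split; first by exists 0; rewrite mulmx0.
by move=> a u v [w ->] [w' ->]; exists (a *: w + w'); rewrite mulmxDr scalemxAr.
Qed.

Lemma dual_image_kernel u : dual_image u -> dual_kernel u.
Proof. by move=> [w ->]; apply: dual_complex. Qed.

(** The obstruction to lifting a cocycle past one variable lies in the cohomology of degree $d + 1$
    of $\operatorname{Hom}(F, R/q_j)$, which is zero by [ext_vanish]. *)
Lemma cocycle_lift j u : (j <= d)%N -> cocycle e.+1 j u ->
  exists u0, dual_kernel u0 /\ qm j (u - u0).
Proof.
have sq i := @power_mx_submod k d t (r e.+1) 1 i.
elim: j u => [|j IH] u jd cu.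
  by exists u; split; [apply/cocycle_mod0 | rewrite subrr; case: (sq 0%N)].
pose jj : 'I_d := Ordinal jd.
have [b [y [qb eb]]] := @power_mx_split _ _ _ _ _ jj _ cu.
have [v] : cobound e.+1 j y.
  apply: ext_vanish; [by rewrite de | exact: ltnW |].
  apply: (@power_mx_regular _ _ _ _ _ jj).
  have -> : 'X_jj ^+ t *: (D e.+2 *m y) = - (D e.+2 *m b).
    apply/eqP; rewrite -addr_eq0 scalemxAr addrC -mulmxDr -eb dual_complex //.
  by apply: (submodN (@power_mx_submod k d t _ _ j)); apply: power_mx_mull.
move=> qv.
have [u0 [k0 q0]] : exists u0, dual_kernel u0 /\ qm j (u - 'X_jj ^+ t *: v - u0).
  apply: IH; first exact: ltnW.
  rewrite /cocycle_mod mulmxBr eb -scalemxAr -addrA -scalerBr.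
  apply: (submodD (@power_mx_submod k d t _ _ j)) => //.
  exact: (submodZ (@power_mx_submod k d t _ _ j)).
exists u0; split=> //.
have -> : u - u0 = (u - 'X_jj ^+ t *: v - u0) + 'X_jj ^+ t *: v by rewrite addrAC subrK.
apply: (submodD (sq _)); first exact: power_mx_le q0.
exact: power_mx_exp.
Qed.

Definition power_cycles (u : 'cV[R]_(r e.+1)) : Prop :=
  exists y : 'I_d -> 'cV[R]_(r e.+1), (forall i, dual_kernel (y i)) /\ u = \sum_i 'X_i ^+ t *: y i.

Lemma power_cycles_submod : is_submod power_cycles.
Proof.
have [k0 kS] := dual_kernel_submod.
split; first by exists (fun _ => 0); split=> //; rewrite big1 // => i _; rewrite scaler0.
move=> a u v [y [ky ->]] [z [kz ->]]; exists (fun i => a *: y i + z i); split=> [i|].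
  exact: (kS a _ _ (ky i) (kz i)).
rewrite scaler_sumr -big_split; apply: eq_bigr => i _ /=.
by rewrite scalerDr !scalerA mulrC.
Qed.

Lemma power_cycles_gen (i : 'I_d) u : dual_kernel u -> power_cycles ('X_i ^+ t *: u).
Proof.
move=> ku; exists (fun l => if l == i then u else 0); split=> [l|].
  by case: eqP => // _; case: dual_kernel_submod.
by rewrite (bigD1 i) //= eqxx big1 ?addr0 // => l /negPf->; rewrite scaler0.
Qed.

Lemma power_cycles_kernel u : power_cycles u -> dual_kernel u.
Proof.
move=> [y [ky ->]]; apply: (submod_sum dual_kernel_submod) => i _.
exact: (submodZ dual_kernel_submod).
Qed.

Lemma power_cycles_power u : power_cycles u -> qm d u.
Proof.
move=> [y [ky ->]]; apply: (submod_sum (@power_mx_submod k d t _ _ d)) => i _.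
exact: power_mx_exp.
Qed.

(* im D^* + (x_1^t, ..., x_d^t) ker D^* *)
Definition thick_image (u : 'cV[R]_(r e.+1)) : Prop :=
  exists w, power_cycles w /\ dual_image (u - w).

Lemma thick_image_submod : is_submod thick_image.
Proof.
have [p0 pS] := power_cycles_submod; have [i0 iS] := dual_image_submod.
split; first by exists 0; rewrite subr0.
move=> a u v [w [pw iw]] [w' [pw' iw']]; exists (a *: w + w'); split.
  exact: (pS a _ _ pw pw').
have -> : a *: u + v - (a *: w + w') = a *: (u - w) + (v - w').
  by rewrite scalerBr opprD addrACA.
exact: (iS a _ _ iw iw').
Qed.

(** At each variable the quotient [y] by $x_j^t$ is congruent to a true cocycle [y0], and $x_j^t
    y_0$ is split off as an element of $q_d \ker D^*$. *)
Lemma cobound_thick_image j u : (j <= d)%N -> dual_kernel u -> cobound e j u -> thick_image u.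
Proof.
have sq i := @power_mx_submod k d t (r e.+1) 1 i.
elim: j u => [|j IH] u jd ku bu.
  exists 0; rewrite subr0; split; first by case: power_cycles_submod.
  by apply/cobound_mod0.
pose jj : 'I_d := Ordinal jd.
case: bu => v /(@power_mx_split _ _ _ _ _ jj) [b [y [qb eb]]].
have cu : cocycle e.+1 j u by apply: (cocycle_mod_le (leq0n _)); apply/cocycle_mod0.
have cy : cocycle e.+1 j y.
  by apply: (cocycle_quotient (j := jj) (v := v) cu); rewrite eb addrK.
have [y0 [ky0 qy0]] := cocycle_lift (ltnW jd) cy.
have [w [pw iw]] : thick_image (u - 'X_jj ^+ t *: y0).
  apply: IH; first exact: ltnW.
    by apply: (submodB dual_kernel_submod) => //; apply: (submodZ dual_kernel_submod).
  exists v.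
  have -> : u - 'X_jj ^+ t *: y0 - D e *m v = b + 'X_jj ^+ t *: (y - y0).
    by rewrite addrAC eb scalerBr addrA.
  by apply: (submodD (sq _)) => //; apply: (submodZ (sq _)).
exists (w + 'X_jj ^+ t *: y0); split.
  by apply: (submodD power_cycles_submod) => //; apply: power_cycles_gen.
by rewrite opprD addrA addrAC.
Qed.

(** With $E = \operatorname{Ext}^d(R/J, R)$, reduction identifies $E/q_d E$ with
    $H^d(\operatorname{Hom}(F, R/q_d))$: it is onto by [cocycle_lift] and injective by
    [cobound_thick_image]. *)
Lemma kdim_thick_image l :
  kdim (V := R^o) J (fun f => forall i : 'I_d, J ('X_i ^+ t * f)) l ->
  kdim thick_image dual_kernel l.
Proof.
move=> /(kdim_cohomology_mod t0 hJ.1 res de) kd.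
have sq := @power_mx_submod k d t (r e.+1) 1 d.
have sB := @cobound_mod_submod k d t r D e d.
pose G (u u0 : 'cV[R]_(r e.+1)) := qm d (u - u0) /\ dual_kernel u0.
apply: (kdim_corr (G := G) _ _ _ _ _ kd).
- by split; [rewrite subrr; case: sq | case: dual_kernel_submod].
- move=> a u u' v v' [qu ku] [qv kv]; split; last exact: (dual_kernel_submod.2 a%:MP _ _ ku kv).
  have -> : a%:MP *: u + v - (a%:MP *: u' + v') = a%:MP *: (u - u') + (v - v').
    by rewrite scalerBr opprD addrACA.
  exact: (sq.2 a%:MP _ _ qu qv).
- by move=> u /(cocycle_lift (leqnn d)) [u0 [k0 q0]]; exists u0.
- move=> u0 k0; exists u0; split; last by split=> //; rewrite subrr; case: sq.
  by apply: (cocycle_mod_le (leq0n _)); apply/cocycle_mod0.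
move=> u u0 [q0 k0]; have b0 := cobound_mod_power D q0; split=> [bu|[w [pw iw]]].
  apply: (cobound_thick_image (leqnn d)) => //.
  by rewrite -(subKr u u0); apply: (submodB sB).
rewrite -(subrK u0 u); apply: (submodD sB) => //.
rewrite -(subrK w u0); apply: (submodD sB).
  by apply: (cobound_mod_le (leq0n _)); apply/cobound_mod0.
exact/cobound_mod_power/power_cycles_power.
Qed.

End TopDegree.
End ExtVanishing.

(** * Finite length of the top Ext module *)

Section TopExt.
Variables (k : fieldType) (d e : nat).
Hypothesis char0 : [pchar k] =i pred0.
Hypothesis de : d = e.+1.
Local Notation R := {mpoly k[d]}.
Variables (J : R -> Prop).
Hypothesis hJ : is_homog_ideal J.
Variables (r : nat -> nat) (D : forall i, 'M[R]_(r i.+1, r i)) (c : 'cV[R]_(r 0%N)).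
Hypothesis res : free_resolution J D c.

(** The dimension of $E/q_d E$ is the same for [t] and [t.+1], so the two submodules agree and $q_d
    E = \mathfrak m q_d E$; Nakayama's lemma and homogeneous annihilators give $q_d E = 0$. *)
Lemma mlength_top_ext l : kdim (V := R^o) J (H0m_pre J) l ->
  mlength (@dual_image k d r D e) (@dual_kernel k d r D e) l.
Proof.
move=> kd; have d0 : (0 < d)%N by rewrite de.
have iJ := hJ.1.
have [t1 ht1] := H0m_pre_uniform d0 iJ.
(* From [t1] on, the elements sent into [J] by all $x_i^t$ form the whole saturation. *)
have kdt t : (t1 <= t)%N -> (0 < t)%N -> kdim (@thick_image k d t r D e) (@dual_kernel k d r D e) l.
  move=> le t0; apply: (kdim_thick_image char0 t0 hJ res de).
  apply: kdim_ext kd => // f; split=> [J'f i|h]; last by apply/(H0m_preP _ d0 iJ); exists t.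
  by apply: expX_le (ht1 _ J'f i).
pose t := t1.+1.
have sI := @dual_image_submod k d r D e.
have sK := @dual_kernel_submod k d r D e.
have sT i := @thick_image_submod k d i r D e.
have thick_kernel i u : @thick_image k d i r D e u -> @dual_kernel k d r D e u.
  move=> [w [/power_cycles_kernel kw iw]]; rewrite -(subrK w u).
  by apply: (submodD sK) => //; apply: (dual_image_kernel res).
have eqT : forall u, @thick_image k d t r D e u -> @thick_image k d t.+1 r D e u.
  apply: (kdim_nested_eq (submod_subspace (sT _)) (submod_subspace (sT _)) _ (thick_kernel t)
           (kdt t.+1 (leqW (leqnSn _)) isT) (kdt t (leqnSn _) isT)).
  move=> u [w [[y [ky ew]] iw]]; exists w; split=> //; exists (fun i => 'X_i *: y i).
  split=> [i|]; first exact: (submodZ sK).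
  by rewrite ew; apply: eq_bigr => i _; rewrite scalerA -exprSr.
have sP := @power_cycles_submod k d t r D e.
have [z pz|a [a1 ha]] := @nakayama_cV k d _ _ _ sP sI.
  have [|w [[y [ky ew]] iw]] := eqT z.
    by exists z; rewrite subrr; split=> //; case: sI.
  exists (fun i => 'X_i ^+ t *: y i); split=> [i|]; first exact: power_cycles_gen.
  by move: iw; rewrite ew; under eq_bigr do rewrite exprS -scalerA.
(* As [a] kills $q_d E$, the product $x_i^t a$ annihilates $E$; so does its component of degree [t],
   which is $x_i^t$ because [a] has constant term 1. *)
have kill (i : 'I_d) u : @dual_kernel k d r D e u -> @dual_image k d r D e ('X_i ^+ t *: u).
  have ann : ext_annihilator t D e 0 ('X_i ^+ t * a).
    move=> v /cocycle_mod0 kv; apply/cobound_mod0; rewrite mulrC -scalerA; apply: ha.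
    exact: power_cycles_gen.
  move=> ku; apply/(cobound_mod0 t).
  have := ext_annihilator_homog hJ res (mdeg (U_(i) *+ t)%MM + 0) char0 ann.
  rewrite mpolyXn hcomp_mulX hcomp0_unit // mulr1 -mpolyXn => h.
  by apply: h; apply/cocycle_mod0.
refine (@mlength_kdim k d _ _ _ l t sI sK _ kill _); first by move=> u; apply: (dual_image_kernel res).
apply: kdim_ext (kdt t _ _) => // u; split=> [[w [[y [ky ew]] iw]]|iu].
  rewrite -(subrK w u); apply: (submodD sI) => //; rewrite ew.
  by apply: (submod_sum sI) => i _; apply: kill.
by exists 0; rewrite subr0; split=> //; case: sP.
Qed.

Lemma ext_length_top l : kdim (V := R^o) J (H0m_pre J) l -> ext_length D d l.
Proof.
(* [ext_length] branches on its index, so [d] is generalised before being replaced by [e.+1]. *)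
move=> /mlength_top_ext h.
suff : forall i, i = e.+1 -> ext_length D i l by apply.
by move=> i ->.
Qed.

End TopExt.

Lemma mlength_H0m (k : fieldType) (d : nat) (J : {mpoly k[d]} -> Prop) l : (0 < d)%N ->
  is_ideal J -> kdim (V := {mpoly k[d]}^o) J (H0m_pre J) l ->
  mlength (V := {mpoly k[d]}^o) J (H0m_pre J) l.
Proof.
move=> d0 iJ kd; have [t ht] := H0m_pre_uniform d0 iJ.
apply: (mlength_kdim (ideal_submod iJ) (ideal_submod (H0m_pre_ideal d0 iJ)) _ _ kd).
  by move=> f; apply: sub_H0m_pre.
by move=> i f /ht; apply.
Qed.

Theorem theorem0p1 (k : fieldType) (d : nat)
  (char0 : [pchar k] =i pred0) (hd : (1 < d)%N)
  (I : {mpoly k[d]} -> Prop) (hI : is_homog_ideal I) :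
  exists (a b : nat -> nat) (L : Rdefinitions.R),
    (* a n = length of H^0_m(R/I^n) *)
    (forall n : nat,
       mlength (V := {mpoly k[d]}^o) (ideal_pow I n) (H0m_pre (ideal_pow I n)) (a n)) /\
    (* b n = length of Ext^d_R(R/I^n, R(-d)), computed from any free resolution *)
    (forall (n : nat) (r : nat -> nat) (D : forall i, 'M[{mpoly k[d]}]_(r i.+1, r i))
            (c : 'cV[{mpoly k[d]}]_(r 0%N)),
       free_resolution (ideal_pow I n) D c -> ext_length D d (b n)) /\
    Rseries.Un_cv (normseq a d) L /\ Rseries.Un_cv (normseq b d) L.
Proof.
have d0 : (0 < d)%N by apply: ltnW.
have [a [L [kd cv]]] := saturation_kdim_cv d0 hI.
(* One sequence gives both lengths, since the twist by $-d$ does not change a length. *)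
exists a, a, L; split=> [n|].
  by apply: mlength_H0m => //; apply: ideal_pow_ideal.
split=> // n r D c res.
apply: (ext_length_top (e := d.-1) char0 _ (ideal_pow_homog n hI) res (kd n)).
by rewrite prednK.
Qed.
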